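(* Let $K$ be a nonempty compact Hausdorff space, and let $H$ be a complex Hilbert space with dimension bigger than or equal to $2$. Then there exists no surjective isometry from the unit sphere of $C(K,H)$ onto the unit sphere of a (complex) C$^*$-algebra.
   Context: $C(K,H)$ is the Banach space of all continuous functions from $K$ to $H$, with the supremum norm. The unit sphere of a Banach space $X$ is $\{x\in X:\|x\|=1\}$, and an isometry between unit spheres is a map preserving the distances induced by the norms. *)

(* Defs.v *)
From HB Require Import structures.
From mathcomp Require Import all_boot all_order all_algebra.
From mathcomp Require Import complex sesquilinear.
From mathcomp Require Import all_classical all_reals all_analysis.

Set Implicit Arguments.
Unset Strict Implicit.
Unset Printing Implicit Defensive.

Import Order.TTheory GRing.Theory Num.Theory.
Import numFieldNormedType.Exports.

Local Open Scope classical_set_scope.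
Local Open Scope complex_scope.
Local Open Scope ring_scope.

(* Norms of a normedModType R[i] take their values in R[i]. An inner product
   {dot H for Num.conj} is linear in its first argument. *)
HB.mixin Record isHilbert (R : realType) H & CompleteNormedModule R[i] H := {
  hdot : {dot H for Num.conj};
  hdot_norm : forall x : H, `|x| ^+ 2 = hdot x x
}.

#[short(type="hilbertType")]
HB.structure Definition Hilbert (R : realType) :=
  {H of CompleteNormedModule R[i] H & isHilbert R H}.

(* No unit is assumed, so the product is an operation cmul on the Banach space
   rather than that of a MathComp ring, which always has a 1. The type
   {linear A -> A | Num.conj \; *:%R} is that of conjugate-linear maps. *)
HB.mixin Record isCStarAlgebra (R : realType) A
    & CompleteNormedModule R[i] A := {
  cmul : {bilinear A -> A -> A};
  cmulA : associative cmul;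
  cstar : {linear A -> A | Num.conj \; *:%R};
  cstarK : involutive cstar;
  cstarM : forall x y : A, cstar (cmul x y) = cmul (cstar y) (cstar x);
  cnormM : forall x y : A, `|cmul x y| <= `|x| * `|y|;
  cnorm_star : forall x : A, `|cmul (cstar x) x| = `|x| ^+ 2
}.

#[short(type="cstarAlgType")]
HB.structure Definition CStarAlgebra (R : realType) :=
  {A of CompleteNormedModule R[i] A & isCStarAlgebra R A}.

(* The dimension of V is at least n: V has n linearly independent vectors. For
   a Hilbert space and a natural number n, algebraic and Hilbert dimension give
   the same condition. *)
Definition dim_ge (K : fieldType) (V : lmodType K) (n : nat) : Prop :=
  exists v : 'I_n -> V,
    forall c : 'I_n -> K, \sum_i c i *: v i = 0 -> forall i, c i = 0.

Definition unit_sphere (K : numFieldType) (X : normedModType K) : set X :=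
  [set x | `|x| = 1].
Arguments unit_sphere : clear implicits.

Definition isometry_on (K : numFieldType) (X Y : normedModType K) (S : set X)
  (f : X -> Y) : Prop := {in S &, forall x y, `|f x - f y| = `|x - y|}.

(* The space C(K, H). The compactness proof is a parameter of the type because
   the sup norm below is a norm only on compact K. *)
Definition cfun_space (R : realType) (K : topologicalType)
  (cK : compact [set: K]) (H : normedModType R[i]) : Type := continuousType K H.

Section cfun_space_normed.
Variables (R : realType) (K : topologicalType) (cK : compact [set: K]).
Variable H : normedModType R[i].
Local Notation C := (cfun_space cK H).
Implicit Types f g : C.

HB.instance Definition _ := Choice.on C.

Let ctsE f : continuous (f : K -> H). Proof. exact: cts_fun. Qed.

Let add_cts f g : continuous ((f : K -> H) \+ g).
Proof. by move=> t; apply: cvgD; exact: ctsE. Qed.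
Let opp_cts f : continuous (\- (f : K -> H)).
Proof. by move=> t; apply: cvgN; exact: ctsE. Qed.
Let scale_cts (a : R[i]) f : continuous (a \*: (f : K -> H)).
Proof. by move=> t; apply: cvgZl_tmp; exact: ctsE. Qed.

Let cadd f g : C := mkcts (@add_cts f g).
Let copp f : C := mkcts (@opp_cts f).
Let cscale a f : C := mkcts (@scale_cts a f).
Let czero : C := cst 0.

Let eqC f g : f =1 g -> f = g. Proof. by move=> ?; exact/continuousEP. Qed.

Let caddA : associative cadd.
Proof. by move=> f g h; apply: eqC => t /=; exact: addrA. Qed.
Let caddC : commutative cadd.
Proof. by move=> f g; apply: eqC => t /=; exact: addrC. Qed.
Let cadd0 : left_id czero cadd.
Proof. by move=> f; apply: eqC => t /=; exact: add0r. Qed.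
Let caddN : left_inverse czero copp cadd.
Proof. by move=> f; apply: eqC => t /=; exact: addNr. Qed.

HB.instance Definition _ := GRing.isZmodule.Build C caddA caddC cadd0 caddN.

Let cscaleA a b f : cscale a (cscale b f) = cscale (a * b) f.
Proof. by apply: eqC => t /=; exact: scalerA. Qed.
Let cscale1 : left_id 1 cscale.
Proof. by move=> f; apply: eqC => t /=; exact: scale1r. Qed.
Let cscaleDr : right_distributive cscale +%R.
Proof. by move=> a f g; apply: eqC => t /=; exact: scalerDr. Qed.
Let cscaleDl f : {morph cscale^~ f : a b / a + b}.
Proof. by move=> a b; apply: eqC => t /=; exact: scalerDl. Qed.

HB.instance Definition _ :=
  GRing.Zmodule_isLmodule.Build R[i] C cscaleA cscale1 cscaleDr cscaleDl.

Definition csup (f : C) : R := sup [set complex.Re `|f t| | t in [set: K]].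

Lemma Re_normE (x : H) : `|x| = (complex.Re `|x|)%:C.
Proof. by rewrite RRe_real// normr_real. Qed.

Lemma cRe_cts (f : C) : continuous (fun t => complex.Re `|f t| : R).
Proof.
move=> t; apply/cvgrPdist_lt => e e0.
have /cvgrPdist_lt/(_ e%:C) := @ctsE f t.
rewrite ltcR => /(_ e0); apply: filterS => s.
rewrite [X in X < _]Re_normE ltcR; apply: le_lt_trans.
rewrite -lecR -Re_normE.
have := ler_dist_dist (f t) (f s); rewrite (Re_normE (f t)) (Re_normE (f s)).
by rewrite -rmorphB/= normc_def/= expr0n/= addr0 sqrtr_sqr.
Qed.

Lemma csup_has_sup (f : C) (t0 : K) :
  has_sup [set complex.Re `|f t| | t in [set: K]].
Proof.
split; first by exists (complex.Re `|f t0|); exists t0.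
have : compact [set complex.Re `|f t| | t in [set: K]].
  apply: continuous_compact => //; apply: continuous_subspaceT => ?.
  exact: cRe_cts.
move/compact_bounded => [M [_ /(_ (M + 1))]].
rewrite ltrDl ltr01 => /(_ isT) Mb; exists (M + 1) => _ [t _ <-].
by apply: le_trans (ler_norm _) _; apply: Mb; exists t.
Qed.

Lemma csup_ub (f : C) t : complex.Re `|f t| <= csup f.
Proof. by apply: (sup_upper_bound (csup_has_sup f t)); exists t. Qed.

Lemma csup_le (f : C) (M : R) : 0 <= M ->
  (forall t, complex.Re `|f t| <= M) -> csup f <= M.
Proof.
move=> M0 fM; have [K0|/set0P[_ [t0 _ _]]] :=
    eqVneq [set complex.Re `|f t| | t in [set: K]] set0.
  by rewrite /csup K0 sup0.
apply: ge_sup; first by exists (complex.Re `|f t0|); exists t0.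
by move=> _ [t _ <-].
Qed.

Lemma Re_norm_ge0 (x : H) : 0 <= complex.Re `|x|.
Proof. by rewrite -lecR -Re_normE; exact: normr_ge0. Qed.

Lemma csup_ge0 (f : C) : 0 <= csup f.
Proof.
have [K0|/set0P[_ [t _ _]]] :=
    eqVneq [set complex.Re `|f t| | t in [set: K]] set0.
  by rewrite /csup K0 sup0.
by apply: le_trans (csup_ub f t); exact: Re_norm_ge0.
Qed.

Let cnorm (f : C) : R[i] := (csup f)%:C.

Let cnormD f g : cnorm (f + g) <= cnorm f + cnorm g.
Proof.
rewrite /cnorm -rmorphD lecR; apply: csup_le => [|t].
  by rewrite addr_ge0// csup_ge0.
apply: le_trans (lerD (csup_ub f t) (csup_ub g t)).
by rewrite -lecR rmorphD/= -!Re_normE; exact: ler_normD.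
Qed.

Let ReZ (a : R[i]) (x : H) :
  complex.Re `|a *: x| = complex.Re `|a| * complex.Re `|x|.
Proof.
rewrite normrZ (Re_normE x) -[in LHS](RRe_real (normr_real a)).
by rewrite -rmorphM.
Qed.

Let cnormZ_le a f : csup (a *: f) <= complex.Re `|a| * csup f.
Proof.
have a0 : 0 <= complex.Re `|a|.
  by rewrite -lecR RRe_real ?normr_real//; exact: normr_ge0.
apply: csup_le => [|t]; first by rewrite mulr_ge0// csup_ge0.
by rewrite [X in X <= _](ReZ a (f t)) ler_wpM2l// csup_ub.
Qed.

Let cnormZ a f : cnorm (a *: f) = `|a| * cnorm f.
Proof.
rewrite /cnorm -[`|a|]RRe_real ?normr_real// -rmorphM; congr (_%:C).
apply/eqP; rewrite eq_le cnormZ_le andTb.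
have [->|a0] := eqVneq a 0; first by rewrite normr0/= mul0r csup_ge0.
have a1 : 0 < complex.Re `|a| by rewrite -ltcR RRe_real ?normr_real// normr_gt0.
rewrite -ler_pdivlMl//.
have := cnormZ_le a^-1 (a *: f); rewrite scalerA mulVf// scale1r.
by rewrite normfV -{1}[`|a|]RRe_real ?normr_real// -fmorphV.
Qed.

Let cnorm0_eq0 f : cnorm f = 0 -> f = 0.
Proof.
move=> /(congr1 (@complex.Re R)) /= f0; apply: eqC => t.
apply/eqP; rewrite -normr_eq0 Re_normE; apply/eqP; congr (_%:C).
by apply/eqP; rewrite eq_le Re_norm_ge0 andbT -f0 csup_ub.
Qed.

HB.instance Definition _ :=
  @Lmodule_isNormed.Build R[i] C cnorm cnormD cnormZ cnorm0_eq0.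

Lemma cfun_normE (f : C) :
  `|f| = (sup [set complex.Re `|f t| | t in [set: K]])%:C.
Proof. by []. Qed.

Lemma cfun_norm_ge (f : C) t : `|f t| <= `|f|.
Proof. by rewrite Re_normE cfun_normE lecR; exact: csup_ub. Qed.

Lemma cfun_norm_le (f : C) (M : R[i]) :
  0 <= M -> (forall t, `|f t| <= M) -> `|f| <= M.
Proof.
move=> M0 fM; rewrite cfun_normE -[M](RRe_real (ger0_real M0)) lecR.
apply: csup_le => [|t]; first by rewrite -lecR RRe_real// ger0_real.
by rewrite -lecR -Re_normE RRe_real// ger0_real.
Qed.
End cfun_space_normed.

Section cfun_space_complete.
Variables (R : realType) (K : topologicalType) (cK : compact [set: K]).
Variable H : completeNormedModType R[i].
Local Notation C := (cfun_space cK H).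

Let lim_uniform (F : set_system C) (l : K -> H) : ProperFilter F -> cauchy F ->
  (forall t, (f : C) t @[f --> F] --> l t) ->
  forall e : R[i], 0 < e -> \forall f \near F, forall t, `|l t - (f : C) t| <= e.
Proof.
move=> FF /cauchyP Fc Fl e e0.
have e4 : 0 < e / 2 / 2 by rewrite !divr_gt0.
have [g] := Fc _ e4; rewrite -ball_normE => Fg; apply: filterS (Fg) => f gf t.
have /cvgrPdist_lt /(_ _ (divr_gt0 e0 (ltr0n _ 2))) lt := Fl t.
have [h [/= gh lh]] := filter_ex (filterI Fg lt).
rewrite (le_trans (ler_distD (h t) _ _))//.
rewrite [leRHS]splitr lerD ?(ltW lh)//.
rewrite (le_trans (ler_distD (g t) _ _))//.
rewrite [leRHS]splitr; apply: lerD.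
  by rewrite distrC; apply: le_trans (ltW gh); exact: (cfun_norm_ge (g - h)).
by apply: le_trans (ltW gf); exact: (cfun_norm_ge (g - f)).
Qed.

Let cfun_complete (F : set_system C) : ProperFilter F -> cauchy F -> cvg F.
Proof.
move=> FF Fc.
have Ft t : cvg ((f : C) t @[f --> F]).
  apply: cauchy_cvg; apply/cauchyP => e e0.
  have /cauchyP /(_ _ e0)[f Ff] := Fc; exists (f t).
  move: Ff; rewrite -ball_normE /nbhs/=; apply: filterS => g /= fg.
  rewrite -ball_normE/=; apply: le_lt_trans fg; exact: (cfun_norm_ge (f - g)).
pose l t := lim ((f : C) t @[f --> F]).
have lu := @lim_uniform F l FF Fc Ft.
have lc : continuous l.
  move=> t; apply/cvgrPdist_lt => e e0.
  have e3 : 0 < e / 2 / 2 by rewrite !divr_gt0.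
  have [f fl] := filter_ex (lu _ e3).
  have /cvgrPdist_lt/(_ _ (divr_gt0 e0 (ltr0n _ 2))) := @cts_fun _ _ f t.
  apply: filterS => s fts.
  apply: le_lt_trans (ler_distD (f t) _ _) _.
  rewrite (@le_lt_trans _ _ (e / 2 / 2 + (`|f t - f s| + e / 2 / 2)))//.
    rewrite lerD// (le_trans (ler_distD (f s) _ _))// lerD// distrC; exact: fl.
  have -> : e / 2 / 2 + (`|f t - f s| + e / 2 / 2) = `|f t - f s| + e / 2.
    rewrite addrCA; congr (_ + _).
    by rewrite -splitr.
  by rewrite [ltRHS]splitr ltrD2r.
apply/cvg_ex; exists (mkcts lc : C); apply/cvgrPdist_le => e e0.
by apply: filterS (lu _ e0) => f fl; apply: cfun_norm_le; [exact: ltW|exact: fl].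
Qed.

HB.instance Definition _ := Uniform_isComplete.Build C cfun_complete.
End cfun_space_complete.

(* Main.v *)
Require Import Defs.
From HB Require Import structures.
From mathcomp Require Import all_boot all_order all_algebra.
From mathcomp Require Import complex sesquilinear ring lra.
From mathcomp Require Import all_classical all_reals all_analysis.

(* Idea: a surjective isometry F from S(X), X = C(K, H), onto S(A) would carry
   two metric properties of S(X) over to S(A).
   (1) If u, u' are the images of the constant functions e, -e (|e| = 1), then
   |g - u|^2 + |g - u'|^2 >= 4 for all g in S(A), by the parallelogram law. Put
   a = (u*u + uu* + u'*u' + u'u'* )/4. Then |1 - a| <= 1, so the Cesaro mean p
   of the first n powers of 1 - a satisfies |ap| <= 2/n. If |p| > eps, take b
   in the unit ball of A such that c = pb has |c| > eps; then g = cc*/|c|^2 is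
   almost annihilated by u, u*, u', u'*, which gives |g - u|, |g - u'| < sqrt 2.
   Hence |p| <= eps for n large, and v = 1 - p is an element of A close to 1.
   (2) Given v_0, ..., v_3 in S(X) there is k in S(X) with |k - v_j| <= sqrt 2
   for all j: as H has real dimension at least 4, some unit vector h satisfies
   Re <h, v_j(t)> >= 0 for all j at a given point t, and k is h times a bump
   function at t. Taking F(v_j) = i^j v/|v| yields x = F(k) in S(A) at distance
   almost sqrt 2 at most from 1, i, -1, -i. So Re x and Im x have norm almost
   sqrt 2 - 1 at most, and |x| < 1, a contradiction.
   Positivity in A is needed without a unit and without spectral theory; it is
   derived for a C*-seminorm on a unital *-algebra and used for the norm of A
   acting on itself, extended to the unitization of A. *)

Set Implicit Arguments.
Unset Strict Implicit.
Unset Printing Implicit Defensive.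

Import Order.TTheory GRing.Theory Num.Theory.
Import numFieldNormedType.Exports.

Local Open Scope classical_set_scope.
Local Open Scope complex_scope.
Local Open Scope ring_scope.

(** * Positivity for a C*-seminorm *)

(** Only a seminorm, because the intended example is the operator norm of the unitization acting on
    A by left multiplication: if A has a unit e, then 1 - e acts as zero. *)
HB.mixin Record isCStarSeminormed (R : realType) B & GRing.Algebra R[i] B := {
  star : {linear B -> B | Num.conj \; *:%R};
  starK : involutive star;
  starM : forall x y : B, star (x * y) = star y * star x;
  snorm : B -> R;
  snormD : forall x y : B, snorm (x + y) <= snorm x + snorm y;
  snormZ : forall (a : R[i]) (x : B),
    snorm (a *: x) = complex.Re `|a| * snorm x;
  snormM : forall x y : B, snorm (x * y) <= snorm x * snorm y;
  snorm1 : snorm 1 = 1;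
  snorm_star_mul : forall x : B, snorm (star x * x) = snorm x ^+ 2
}.

#[short(type="cstarSeminormedType")]
HB.structure Definition CStarSeminormed (R : realType) :=
  {B of GRing.Algebra R[i] B & isCStarSeminormed R B}.

Section CStarSeminormed.
Variables (R : realType) (B : cstarSeminormedType R).
Implicit Types (x y z : B) (c t e : R).

Local Notation N := (@snorm R B).
Local Notation S := (@star R B).
Local Notation sa x := (S x = x).
Local Notation "c %:B" := (c%:C%:A : B) (at level 2, format "c %:B").

(** * Rules for the seminorm, the involution and self-adjoint elements *)

Lemma Re_norm_real c : complex.Re `|c%:C| = `|c|.
Proof. by rewrite normc_def/= expr0n/= addr0 sqrtr_sqr. Qed.

Lemma snormRZ c x : N (c%:C *: x) = `|c| * N x.
Proof. by rewrite snormZ Re_norm_real. Qed.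

Lemma snormN x : N (- x) = N x.
Proof. by rewrite -scaleN1r snormZ normrN1 mul1r. Qed.

Lemma snorm0 : N 0 = 0.
Proof. by rewrite -(scale0r (0 : B)) snormZ normr0 mul0r. Qed.

Lemma snorm_ge0 x : 0 <= N x.
Proof.
by have := snormD x (- x); rewrite subrr snorm0 snormN -mulr2n pmulrn_lge0.
Qed.

Lemma snormB x y : N (x - y) <= N x + N y.
Proof. by rewrite -(snormN y) snormD. Qed.

Lemma snorm_distC x y : N (x - y) = N (y - x).
Proof. by rewrite -opprB snormN. Qed.

Lemma snorm_star x : N (star x) = N x.
Proof.
suff le y : N y <= N (star y) by apply/eqP; rewrite eq_le le -{2}(starK x) le.
have := snormM (star y) y; rewrite snorm_star_mul expr2.
have := snorm_ge0 y; rewrite le_eqVlt => /orP[/eqP <- _|y0].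
  exact: snorm_ge0.
by rewrite ler_pM2r.
Qed.

Lemma starD x y : S (x + y) = S x + S y.
Proof. exact: raddfD. Qed.

Lemma starB x y : S (x - y) = S x - S y.
Proof. exact: raddfB. Qed.

Lemma starR c x : S (c%:C *: x) = c%:C *: S x.
Proof. by rewrite linearZ/=; congr (_ *: _); exact: conjc_real. Qed.

Lemma starI x : S ('i%R *: x) = - ('i%R *: S x).
Proof. by rewrite linearZ/= conjCi scaleNr. Qed.

Lemma star1 : sa (1 : B).
Proof.
by rewrite -[RHS](starK 1) -[X in _ = star X]mul1r starM starK mul1r.
Qed.

Lemma star_real c : sa c%:B.
Proof. by rewrite starR star1. Qed.

Lemma sa_sqr x : sa x -> sa (x * x).
Proof. by move=> sx; rewrite starM sx. Qed.

Lemma sa_starM x : sa (S x * x).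
Proof. by rewrite starM starK. Qed.

Lemma sa_add x y : sa x -> sa y -> sa (x + y).
Proof. by move=> sx sy; rewrite starD sx sy. Qed.

Lemma sa_sub x y : sa x -> sa y -> sa (x - y).
Proof. by move=> sx sy; rewrite starB sx sy. Qed.

Lemma sa_exp x n : sa x -> sa (x ^+ n).
Proof.
move=> sx; elim: n => [|n IH]; first by rewrite expr0 star1.
by rewrite exprS starM sx IH -exprSr -exprS.
Qed.

Lemma comm_real c x : GRing.comm x c%:B.
Proof. by rewrite /GRing.comm mulr_algl mulr_algr. Qed.

Lemma snorm_real c : N c%:B = `|c|.
Proof. by rewrite snormRZ snorm1 mulr1. Qed.

Lemma realB_D c t : (c + t)%:B = c%:B + t%:B.
Proof. by rewrite rmorphD/= scalerDl. Qed.

Lemma realB_N c : (- c)%:B = - c%:B.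
Proof. by rewrite rmorphN/= scaleNr. Qed.

Lemma realB_M c t : (c * t)%:B = c%:B * t%:B.
Proof. by rewrite rmorphM/= mulr_algl scalerA. Qed.

Lemma realB_1 : 1%:B = 1 :> B.
Proof. by rewrite scale1r. Qed.

(** * Norms of squares of self-adjoint elements *)

Lemma snorm_sqr x : sa x -> N (x * x) = N x ^+ 2.
Proof. by move=> sx; rewrite -{1}sx snorm_star_mul. Qed.

Lemma snorm_cartesian p q : sa p -> sa q -> GRing.comm p q ->
  N (p + 'i%R *: q) ^+ 2 = N (p * p + q * q).
Proof.
move=> sp sq cpq; rewrite -snorm_star_mul starD starI sp sq; set y := 'i *: q.
have yy : y * y = - (q * q).
  by rewrite /y -scalerAl -scalerAr scalerA -expr2 sqrCi scaleN1r.
have py : p * y = y * p by rewrite /y -scalerAl -scalerAr cpq.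
by rewrite mulrDl mulNr !mulrDr yy py opprD opprK addrA addrK.
Qed.

Lemma snorm_Re p q : sa p -> sa q -> N p <= N (p + 'i%R *: q).
Proof.
move=> sp sq; set u := _ + _.
have e : 2%:C *: p = u + S u.
  rewrite /u starD starI sp sq addrACA subrr addr0.
  by rewrite -mulr2n -[RHS]scaler_nat rmorph_nat.
have := snormRZ 2 p; rewrite e ger0_norm// => e2.
have := snormD u (S u); rewrite e2 snorm_star; lra.
Qed.

(* c - x^2 is the real part of u = (c - x^2) + i sqrt(2c) x, and
   u*u = c^2 + x^4. *)
Lemma snorm_real_sub_sqr_le c x : sa x -> 0 <= c ->
  N (c%:B - x * x) ^+ 2 <= c ^+ 2 + N x ^+ 4.
Proof.
move=> sx c0; set p := _ - _; set q := (Num.sqrt (2 * c))%:C *: x.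
have sp : sa p by apply: sa_sub; [exact: star_real|exact: sa_sqr].
have sq : sa q by rewrite starR sx.
have cxp : GRing.comm x p.
  apply: commrB; [exact: comm_real|by rewrite /GRing.comm mulrA].
have cpq : GRing.comm p q.
  by rewrite /GRing.comm/q -scalerAl -scalerAr cxp.
apply: (@le_trans _ _ (N (p * p + q * q))).
  rewrite -(snorm_cartesian sp sq cpq).
  by rewrite lerXn2r ?nnegrE ?snorm_ge0// snorm_Re.
have -> : p * p + q * q = (c ^+ 2)%:B + (x * x) * (x * x).
  have ss : Num.sqrt (2 * c) * Num.sqrt (2 * c) = c + c.
    by rewrite -expr2 sqr_sqrtr ?mulr_ge0// mulr_natl mulr2n.
  rewrite /q -scalerAl -scalerAr scalerA -rmorphM/= ss.
  rewrite -[_ *: (x * x)]mulr_algl realB_D.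
  rewrite /p mulrBl !mulrBr (comm_real c (x * x)) opprB mulrDl.
  by rewrite addrACA !subrK expr2 realB_M.
apply: le_trans (snormD _ _) _; rewrite snorm_real ger0_norm ?sqr_ge0// lerD2l.
by rewrite snorm_sqr ?snorm_sqr ?sa_sqr// -exprM.
Qed.

Lemma subr_sqr_comm x y : GRing.comm x y -> (x - y) * (x + y) = x * x - y * y.
Proof. by move=> cxy; rewrite mulrBl !mulrDr cxy opprD addrA addrK. Qed.

(* The inequality at c = N x ^+ 2 propagates to larger c by convexity. *)
Lemma snorm_real_add_sqr c x : sa x -> 0 <= c ->
  c + N x ^+ 2 <= N (c%:B + x * x).
Proof.
move=> sx c0; set b := N x.
have b0 : 0 <= b := snorm_ge0 x.
(* For u = b + i x, the squares of u and [star u] differ by 4 b i x, so 4 b^2 <= 2 N(u)^2, and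
   N(u)^2 = N(b^2 + x^2). *)
have key : 2 * b ^+ 2 <= N ((b ^+ 2)%:B + x * x).
  have cbx : GRing.comm b%:B x by exact/commr_sym/comm_real.
  have := snorm_cartesian (star_real b) sx cbx; rewrite -realB_M -expr2 => <-.
  set u := b%:B + _; set y := 'i%R *: x.
  have by_ : b%:B * y = y * b%:B by exact/commr_sym/comm_real.
  have e : (4 * b)%:C *: y = u * u - S u * S u.
    have su : S u = b%:B - y by rewrite /u starD starI sx star_real.
    have cus : u * S u = S u * u.
      have cu z : GRing.comm z b%:B -> GRing.comm z y -> z * S u = S u * z.
        by move=> zb zy; rewrite su; exact: commrB.
      apply: cu; apply/commr_sym/commrD => //; exact: commr_refl.
    rewrite -subr_sqr_comm// su /u opprB addrC addrA subrK addrACA subrr addr0.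
    rewrite -realB_D mulr_algr.
    by rewrite scalerDr -scalerDl -rmorphD/=; congr (_%:C *: _); ring.
  have := snormB (u * u) (S u * S u).
  rewrite -e snormRZ ger0_norm ?mulr_ge0// /y snormZ normCi mul1r -/b.
  have := snormM u u; have := snormM (S u) (S u); rewrite snorm_star.
  lra.
have [b_0|bn0] := eqVneq b 0.
  have := snormB (c%:B + x * x) (x * x).
  by rewrite addrK snorm_real ger0_norm// snorm_sqr// -/b b_0 expr0n/= !addr0.
(* Up to c = b^2 the triangle inequality suffices; beyond it, c (b^2 + x^2) is split into (c - b^2)
   x^2 and b^2 (c + x^2). *)
have [cb|/ltW cb] := leP c (b ^+ 2).
  have := snormD (c%:B + x * x) (b ^+ 2 - c)%:B.
  rewrite addrAC -realB_D subrKC snorm_real ger0_norm ?subr_ge0//.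
  lra.
have e : c%:C *: ((b ^+ 2)%:B + x * x) =
    (c - b ^+ 2)%:C *: (x * x) + (b ^+ 2)%:C *: (c%:B + x * x).
  rewrite !scalerDr !scalerA -!rmorphM/= [c * _]mulrC addrCA; congr (_ + _).
  by rewrite -scalerDl -rmorphD subrK.
have := snormD ((c - b ^+ 2)%:C *: (x * x)) ((b ^+ 2)%:C *: (c%:B + x * x)).
rewrite -e !snormRZ !ger0_norm ?subr_ge0 ?sqr_ge0// snorm_sqr// -/b => le.
have b2 : 0 < b ^+ 2 by rewrite exprn_gt0// lt_def bn0.
rewrite -(ler_pM2l b2); nra.
Qed.

(** * Approximate square roots *)

(* If y = lim sqrt_iter z n, then (1 - y)^2 = 1 - z. The rate of convergence is
   read off the scalar iteration for z = 1. *)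
Fixpoint sqrt_iter z n :=
  if n is m.+1 then 2^-1%:C *: (z + sqrt_iter z m * sqrt_iter z m) else 0.

Fixpoint sqrt_iterR n : R :=
  if n is m.+1 then (1 + sqrt_iterR m ^+ 2) / 2 else 0.

(** The gap d = 1 - t evolves by d -> d - d^2 / 2, whose solutions decay like 2 / n; one step
    preserves the bound 2 / (n + 2). *)
Lemma sqrt_iterR_bound n : 0 <= sqrt_iterR n <= 1 /\
  n.+2%:R * (1 - sqrt_iterR n) <= 2.
Proof.
elim: n => [|n [/andP[t0 t1] IH]] /=; first by split; lra.
split; first by apply/andP; split; nra.
set t := sqrt_iterR n in t0 t1 IH *.
have n0 : 0 <= n%:R :> R by [].
move: IH; rewrite -!(natr1 n.+2) -!(natr1 n.+1) -!(natr1 n).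
move: n0; set a := n%:R => a0 IH.
have -> : 1 - (1 + t ^+ 2) / 2 = (1 - t) - (1 - t) ^+ 2 / 2 by field.
move: IH; set d := 1 - t => IH.
have d0 : 0 <= d by rewrite /d; lra.
have d1 : d <= 1 by rewrite /d; lra.
have /orP[h|h] := le_total ((a + 2) * d) 1; nra.
Qed.

Lemma sqrt_iter_sa z n : sa z -> sa (sqrt_iter z n).
Proof.
move=> sz; elim: n => [|n IH] /=; first by rewrite raddf0.
by rewrite starR starD sz starM IH.
Qed.

Lemma sqrt_iter_comm z w n : GRing.comm w z -> GRing.comm w (sqrt_iter z n).
Proof.
move=> wz; elim: n => [|n IH] /=; first exact: commr0.
rewrite /GRing.comm -scalerAl -scalerAr; congr (_ *: _).
by apply: commrD => //; exact: commrM.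
Qed.

Lemma scale_half_double x : 2^-1%:C *: (x + x) = x.
Proof.
rewrite -mulr2n -[x *+ 2]scaler_nat scalerA.
have -> : (2%:R : R[i]) = 2%:C by rewrite rmorph_nat.
by rewrite -rmorphM/= mulVf ?pnatr_eq0// scale1r.
Qed.

(** The scalar iteration is a majorant: as the iterates commute, the next increment is
    [(y' - y) * (y' + y) / 2] in both iterations. *)
Lemma sqrt_iter_bound z n : N z <= 1 -> N (sqrt_iter z n) <= sqrt_iterR n /\
  N (sqrt_iter z n.+1 - sqrt_iter z n) <= sqrt_iterR n.+1 - sqrt_iterR n.
Proof.
move=> z1.
have h0 : 0 <= 2^-1 :> R by rewrite invr_ge0.
elim: n => [|n [IH1 IH2]].
  rewrite /= snorm0 !subr0 mulr0 expr0n/= !addr0 snormRZ ger0_norm//.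
  by split => //; rewrite mul1r ler_piMr.
set y := sqrt_iter z n in IH1 IH2 *; set y' := sqrt_iter z n.+1 in IH2 *.
set t := sqrt_iterR n in IH1 IH2 *; set t' := sqrt_iterR n.+1 in IH2 *.
have y't' : N y' <= t' by have := snormD (y' - y) y; rewrite subrK; lra.
split => //.
have e : sqrt_iter z n.+2 - y' = 2^-1%:C *: ((y' - y) * (y' + y)).
  rewrite subr_sqr_comm; last first.
    by apply: sqrt_iter_comm; exact/commr_sym/sqrt_iter_comm.
  have -> : sqrt_iter z n.+2 = 2^-1%:C *: (z + y' * y') by [].
  have {2}-> : y' = 2^-1%:C *: (z + y * y) by [].
  rewrite -scalerBr; congr (_ *: _).
  by rewrite opprD addrACA subrr add0r.
have e' : sqrt_iterR n.+2 - t' = 2^-1 * ((t' - t) * (t' + t)).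
  have -> : sqrt_iterR n.+2 = (1 + t' ^+ 2) / 2 by [].
  have {2}-> : t' = (1 + t ^+ 2) / 2 by [].
  by field.
rewrite e e' snormRZ ger0_norm// ler_wpM2l//.
apply: le_trans (snormM _ _) _; apply: ler_pM; rewrite ?snorm_ge0//.
by apply: le_trans (snormD _ _) _; exact: lerD.
Qed.

(** An approximate root replaces the limit, since a seminormed algebra need not be complete. The
    residual of the n-th iterate is twice the next increment, hence at most
    [(1 - sqrt_iterR n) ^+ 2]. *)
Lemma sqrt_approx z e : sa z -> N z <= 1 -> 0 < e ->
  exists y, [/\ sa y, (forall w, GRing.comm w z -> GRing.comm w y)
                    & N (y * y - (1 - z)) <= e].
Proof.
move=> sz z1 e0.
have [n en] : exists n, 4 / e < n%:R.
  by exists (Num.bound (4 / e)); rewrite archi_boundP// divr_ge0// ltW.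
exists (1 - sqrt_iter z n); split.
- by rewrite starB star1 sqrt_iter_sa.
- by move=> w wz; apply: commrB; [exact: commr1|exact: sqrt_iter_comm].
set y := sqrt_iter z n.
have [_ yb] := sqrt_iter_bound n z1.
have [/andP[t0 t1] tn] := sqrt_iterR_bound n.
have -> : (1 - y) * (1 - y) - (1 - z) = 2%:C *: (sqrt_iter z n.+1 - y).
  rewrite /= -/y scalerBr scalerA -rmorphM/= divff ?pnatr_eq0// scale1r.
  rewrite rmorph_nat scaler_nat mulr2n mulrBl mul1r mulrBr mulr1 !opprB.
  by rewrite addrC addrA [z - 1 + _]addrA subrK addrACA -opprD.
rewrite snormRZ ger0_norm//.
rewrite ltr_pdivrMr// in en.
move: yb tn; rewrite /= -/y -(natr1 n.+1) -(natr1 n).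
set a := N _; set t := sqrt_iterR n in t0 t1 *.
have n0 : 0 <= n%:R :> R by [].
move: n0 en; set b := n%:R => b0 en yb tn.
have {}yb : a <= (1 - t) ^+ 2 / 2.
  by apply: le_trans yb _; rewrite le_eqVlt; apply/orP; left; apply/eqP; field.
move: yb tn t0 t1; set d := 1 - t => yb tn t0 t1.
have d0 : 0 <= d by rewrite /d; lra.
have d1 : d <= 1 by rewrite /d; lra.
have : d * (b + 2) <= 2 by lra.
have : d * d <= d by nra.
nra.
Qed.

(** * The cone of positive elements *)

(* N (c%:B - z) - c is nonincreasing in c and, for self-adjoint z, tends to
   - inf (spectrum of z) as c goes to infinity. *)
Definition pos z :=
  forall e, 0 < e -> exists2 c, 0 <= c & N (c%:B - z) <= c + e.

Lemma pos_widen z c d e : c <= d -> N (c%:B - z) <= c + e ->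
  N (d%:B - z) <= d + e.
Proof.
move=> cd le; have := snormD (c%:B - z) (d - c)%:B.
rewrite addrAC -realB_D subrKC snorm_real ger0_norm ?subr_ge0//; lra.
Qed.

Lemma posD x y : pos x -> pos y -> pos (x + y).
Proof.
move=> px py e e0; have e2 : 0 < e / 2 by rewrite divr_gt0.
have [c c0 cx] := px _ e2; have [d d0 dy] := py _ e2.
exists (c + d); first exact: addr_ge0.
have := snormD (c%:B - x) (d%:B - y); rewrite addrACA -opprD -realB_D.
by move/le_trans; apply; lra.
Qed.

Lemma pos0 : pos 0.
Proof.
by move=> e e0; exists 0 => //; rewrite subr0 snorm_real normr0 add0r ltW.
Qed.

Lemma posZ t x : 0 <= t -> pos x -> pos (t%:C *: x).
Proof.
rewrite le_eqVlt => /orP[/eqP <- _|t0 px e e0].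
  by rewrite scale0r; exact: pos0.
have [c c0 cx] := px _ (divr_gt0 e0 t0); exists (t * c).
  by rewrite mulr_ge0// ltW.
have -> : (t * c)%:B - t%:C *: x = t%:C *: (c%:B - x).
  by rewrite scalerBr scalerA -rmorphM.
rewrite snormRZ gtr0_norm// -ler_pdivlMl// mulrDr mulrA mulVf ?gt_eqF// mul1r.
by rewrite mulrC.
Qed.

Lemma pos_closed x : (forall e, 0 < e -> exists2 y, pos y & N (y - x) <= e) ->
  pos x.
Proof.
move=> h e e0; have e2 : 0 < e / 2 by rewrite divr_gt0.
have [y py yx] := h _ e2; have [c c0 cy] := py _ e2; exists c => //.
have := snormD (c%:B - y) (y - x); rewrite addrA subrK; lra.
Qed.

Lemma pos_sqr x : sa x -> pos (x * x).
Proof.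
move=> sx e e0; set b := N x ^+ 4.
have b0 : 0 <= b by rewrite exprn_ge0// snorm_ge0.
have c0 : 0 <= b / e by rewrite divr_ge0// ltW.
(* The square of c + e exceeds c^2 by 2 c e + e^2, and c e = b. *)
exists (b / e) => //.
have := snorm_real_sub_sqr_le sx c0; rewrite -/b => le.
rewrite -(@ler_pXn2r _ 2)// ?nnegrE ?snorm_ge0 ?addr_ge0 ?(ltW e0)//.
apply: le_trans le _; rewrite sqrrD -addrA lerD2l.
rewrite -[b / e * e]mulrA mulVf ?gt_eqF// mulr1 mulr2n.
have := sqr_ge0 e; lra.
Qed.

(** 1 - z is a limit of squares of self-adjoint elements, for which the bound is
    [snorm_real_add_sqr]. *)
Lemma snorm_shift z t : sa z -> N z <= 1 -> 0 <= t ->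
  t + N (1 - z) <= N ((t + 1)%:B - z).
Proof.
move=> sz z1 t0; apply/ler_addgt0Pr => e e0.
have e2 : 0 < e / 2 by rewrite divr_gt0.
have [y [sy _ ye]] := sqrt_approx sz z1 e2.
have := snorm_real_add_sqr sy t0; rewrite -snorm_sqr//.
have := snormB (y * y) (y * y - (1 - z)); rewrite subKr.
have := snormD ((t + 1)%:B - z) (y * y - (1 - z)).
have -> : (t + 1)%:B - z + (y * y - (1 - z)) = t%:B + y * y.
  by rewrite realB_D realB_1 -[_ + 1 - z]addrA addrACA subrr addr0.
lra.
Qed.

(** By [snorm_shift] for p / c, the nonincreasing quantity N(d - p) - d is constant for d >= c.
    Positivity makes its infimum at most 0, so its value at c is at most 0 too. *)
Lemma pos_snorm p c : sa p -> pos p -> N p <= c -> N (c%:B - p) <= c.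
Proof.
move=> sp pp pc; have := le_trans (snorm_ge0 p) pc.
rewrite le_eqVlt => /orP[/eqP c0|c0].
  by rewrite -c0 in pc *; rewrite scale0r sub0r snormN.
have ci : 0 < c^-1 by rewrite invr_gt0.
pose z := c^-1%:C *: p.
have sz : sa z by rewrite starR sp.
have z1 : N z <= 1.
  by rewrite snormRZ gtr0_norm// -ler_pdivlMl ?invrK ?mulr1.
have cz d : (c * d)%:B - p = c%:C *: (d%:B - z).
  by rewrite scalerBr !scalerA -!rmorphM/= divff ?gt_eqF// scale1r.
suff : N (1 - z) <= 1.
  move=> le; rewrite -[X in X%:B]mulr1 cz snormRZ gtr0_norm// realB_1.
  by rewrite ger_pMr.
apply/ler_addgt0Pr => e e0.
have [d d0 dp] := pp _ (mulr_gt0 e0 c0).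
have t0 : 0 <= d / c by rewrite divr_ge0// ltW.
have := snorm_shift sz z1 t0.
have := @pos_widen p d (d + c) _ _ dp; rewrite lerDl => /(_ (ltW c0)).
have -> : d + c = c * (d / c + 1) by field; rewrite gt_eqF.
rewrite cz snormRZ gtr0_norm// [e * c]mulrC -mulrDr ler_pM2l//.
lra.
Qed.

Lemma pos_sqrt p e : sa p -> pos p -> N p <= 1 -> 0 < e ->
  exists y, [/\ sa y, (forall w, GRing.comm w p -> GRing.comm w y)
                    & N (y * y - p) <= e].
Proof.
move=> sp pp p1 e0; have := pos_snorm sp pp p1; rewrite realB_1 => q1.
have sq : sa (1 - p) by rewrite starB star1 sp.
have [y [sy cy ye]] := sqrt_approx sq q1 e0.
exists y; split=> //; last by rewrite subKr in ye.
by move=> w wp; apply: cy; apply: commrB => //; exact: commr1.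
Qed.

(** p and q are close to squares of commuting self-adjoint y and w, so p q is close to the square of
    y w. *)
Lemma pos_mul p q : sa p -> sa q -> pos p -> pos q -> GRing.comm p q ->
  pos (p * q).
Proof.
wlog [p1 q1] : p q / N p <= 1 /\ N q <= 1.
  move=> h sp sq pp pq cpq.
  have d0 x : 0 < 1 + N x by rewrite ltr_pwDl// snorm_ge0.
  pose f x := (1 + N x)^-1%:C *: x.
  have f1 x : N (f x) <= 1.
    rewrite snormRZ gtr0_norm ?invr_gt0// -ler_pdivlMl ?invr_gt0//.
    by rewrite invrK mulr1 lerDr.
  have sf x : sa x -> sa (f x) by rewrite starR => ->.
  have pf x : pos x -> pos (f x) by apply: posZ; rewrite invr_ge0 ltW.
  have : pos (f p * f q).
    apply: h; rewrite ?f1; auto.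
    by rewrite /GRing.comm/f -!scalerAl -!scalerAr cpq scalerA mulrC -scalerA.
  move/(posZ (ltW (mulr_gt0 (d0 p) (d0 q)))).
  rewrite /f -scalerAl -scalerAr !scalerA -!rmorphM/=.
  rewrite [X in X%:C](_ : _ = 1) ?scale1r//.
  by field; rewrite !gt_eqF.
move=> sp sq pp pq cpq; apply: pos_closed => e e0.
have e2 : 0 < e / 2 / 2 by rewrite !divr_gt0.
(* The 1 bounds N(w^2) by 2; the two errors are then at most e / 2 and e / 4. *)
have m0 : 0 < Num.min 1 (e / 2 / 2) by rewrite lt_min ltr01.
have [y [sy cy ye]] := pos_sqrt sp pp p1 m0.
have [w [sw cw we]] := pos_sqrt sq pq q1 m0.
have cyw : GRing.comm y w.
  by apply: cw; apply/commr_sym/cy/commr_sym.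
exists ((y * w) * (y * w)); first by apply: pos_sqr; rewrite starM sy sw.
have -> : y * w * (y * w) = (y * y) * (w * w).
  by rewrite -mulrA (mulrA w) -cyw !mulrA.
have -> : y * y * (w * w) - p * q =
    (y * y - p) * (w * w) + p * (w * w - q).
  by rewrite mulrBl mulrBr addrA subrK.
move: ye we; rewrite !le_min => /andP[_ ye] /andP[w1 we].
have ww : N (w * w) <= 2 by have := snormD (w * w - q) q; rewrite subrK; lra.
have := snormD ((y * y - p) * (w * w)) (p * (w * w - q)).
have := snormM (y * y - p) (w * w); have := snormM p (w * w - q).
have := snorm_ge0 p; have := snorm_ge0 (w * w - q).
have := snorm_ge0 (w * w); have := snorm_ge0 (y * y - p).
nra.
Qed.

(** The product t^2 - m^2 of the two positive elements is positive, so N(c + m^2) <= c + t^2 + e for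
    some c >= 0, whereas the left side is at least c + N(m)^2. *)
Lemma snorm_le m t : sa m -> 0 <= t -> pos (t%:B - m) -> pos (t%:B + m) ->
  N m <= t.
Proof.
move=> sm t0 p1 p2; rewrite -(@ler_pXn2r _ 2)// ?nnegrE ?snorm_ge0//.
have ctm : GRing.comm t%:B m by exact/commr_sym/comm_real.
have := pos_mul _ _ p1 p2.
rewrite starB starD sm star_real => /(_ erefl erefl).
rewrite subr_sqr_comm// -realB_M -expr2 => h.
have {}h : pos ((t ^+ 2)%:B - m * m).
  apply: h; apply: commrD; first exact: comm_real.
  by apply/commr_sym/commrB => //; exact: commr_refl.
apply/ler_addgt0Pr => e e0; have [c c0 ce] := h _ e0.
have t20 : 0 <= t ^+ 2 by rewrite sqr_ge0.
have := @pos_widen _ c (c + t ^+ 2) e _ ce; rewrite lerDl => /(_ t20).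
rewrite realB_D opprB addrACA subrr addr0.
by have := snorm_real_add_sqr sm c0; lra.
Qed.

(** * Powers, and positivity of [star x * x] *)

Lemma snorm_exp_le x n : N (x ^+ n) <= N x ^+ n.
Proof.
elim: n => [|n IH]; first by rewrite !expr0 snorm1.
rewrite !exprS; apply: le_trans (snormM _ _) _.
by rewrite ler_wpM2l ?snorm_ge0.
Qed.

(** Iterating the C*-identity settles the exponents 2 ^ k. Splitting 2 ^ n as n + (2 ^ n - n) then
    forces equality at n. *)
Lemma snorm_exp x n : sa x -> N (x ^+ n) = N x ^+ n.
Proof.
move=> sx; apply/eqP; rewrite eq_le snorm_exp_le/=.
have pow2 k : N (x ^+ (2 ^ k)) = N x ^+ (2 ^ k).
  elim: k => [|k IH]; first by rewrite expn0 !expr1.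
  by rewrite expnSr !exprM [X in N X]expr2 snorm_sqr ?IH//; exact: sa_exp.
have [x0|x0] := eqVneq (N x) 0.
  case: n => [|n]; first by rewrite !expr0 snorm1.
  by rewrite x0 expr0n/= snorm_ge0.
have nk : (n <= 2 ^ n)%N by rewrite ltnW// ltn_expl.
have := pow2 n; rewrite -(subnKC nk) !exprD => e.
have := snormM (x ^+ n) (x ^+ (2 ^ n - n)); rewrite e => le.
have xp : 0 < N x ^+ (2 ^ n - n) by rewrite exprn_gt0// lt_def x0 snorm_ge0.
rewrite -(ler_pM2r xp); apply: le_trans le _.
by rewrite ler_wpM2l ?snorm_ge0// snorm_exp_le.
Qed.

Lemma pos_of_snorm z c : 0 <= c -> N (c%:B - z) <= c -> pos z.
Proof.
by move=> c0 cz e e0; exists c => //; rewrite (le_trans cz)// lerDl ltW.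
Qed.

Lemma pos_exp z n : sa z -> pos z -> pos (z ^+ n).
Proof.
move=> sz pz; elim: n => [|n IH].
  by rewrite expr0 -(mulr1 1); apply: pos_sqr; exact: star1.
rewrite exprS; apply: pos_mul => //; first exact: sa_exp.
by apply: commrX; exact: commr_refl.
Qed.

(** Meant for h = [star x * x] while its positivity is still to be shown. The induction adds only
    h^2 w^m: 1 - h w^(m+1) = (1 - h w^m) + h^2 w^m. *)
Lemma pos_one_sub_mul_exp h m : sa h -> N h <= 1 -> pos (1 - h * (1 - h) ^+ m).
Proof.
move=> sh h1; set w := 1 - h.
have sw : sa w by rewrite starB star1 sh.
have pw : pos w by apply: (@pos_of_snorm _ 1); rewrite ?realB_1 ?subKr.
have chw n : GRing.comm h (w ^+ n).
  by apply: commrX; apply: commrB; [exact: commr1|exact: commr_refl].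
elim: m => [|m IH]; first by rewrite expr0 mulr1.
have -> : 1 - h * w ^+ m.+1 = (1 - h * w ^+ m) + (h * h) * w ^+ m.
  rewrite exprS /w mulrBl mul1r -/w mulrBr opprB mulrA.
  by rewrite addrCA addrC.
apply: posD => //; apply: pos_mul; rewrite ?starM ?sh//.
- exact: sa_exp.
- exact: pos_sqr.
- exact: pos_exp.
- by apply/commr_sym/commrM; apply/commr_sym.
Qed.

Lemma pos_star_sym y : pos (S y * y + y * S y).
Proof.
pose a := y + S y; pose b := 'i%R *: (y - S y).
have sqa : pos (a * a) by apply: pos_sqr; rewrite starD starK addrC.
have sqb : pos (b * b).
  by apply: pos_sqr; rewrite starI starB starK -scalerN opprB.
have h0 : 0 <= 2^-1 :> R by rewrite invr_ge0.
rewrite -[X in pos X]scale_half_double; have := posZ h0 (posD sqa sqb).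
rewrite [X in _%:C *: X](_ : _ = S y * y + y * S y + (S y * y + y * S y))//.
have -> : b * b = - ((y - S y) * (y - S y)).
  by rewrite /b -scalerAl -scalerAr scalerA -expr2 sqrCi scaleN1r.
rewrite /a mulrDl mulrBl !mulrBr !mulrDr; set p := y * y; set q := S y * S y.
set u := y * S y; set v := S y * y.
have -> : p + u + (v + q) = p + q + (v + u).
  by rewrite [v + q]addrC addrACA [u + v]addrC.
have -> : p - u - (v - q) = p + q - (v + u).
  by rewrite opprB opprD [- v - u]addrC addrACA.
by rewrite opprB addrC addrA subrK.
Qed.

Lemma bernoulli_ineq (d : R) n : 0 <= d -> 1 + n%:R * d <= (1 + d) ^+ n.
Proof.
move=> d0; elim: n => [|n IH]; first by rewrite mul0r addr0 expr0.
rewrite exprSr -natr1; have n0 : 0 <= n%:R :> R by []; nra.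
Qed.

Lemma star_mul_comm_exp x n : x * (1 - S x * x) ^+ n = (1 - x * S x) ^+ n * x.
Proof.
elim: n => [|n IH]; first by rewrite !expr0 mulr1 mul1r.
by rewrite exprSr mulrA IH exprSr -!mulrA mulrBr mulrBl mulr1 mul1r !mulrA.
Qed.

(* Kaplansky's theorem. With w = 1 - x*x and y = x w^n, both y*y = x*x w^2n and
   yy* are at most 1, while y*y + yy* is positive; so y*y has norm at most 1 for
   all n, which forces N w <= 1. *)
Lemma pos_star_mul_le1 x : N x <= 1 -> pos (S x * x).
Proof.
move=> x1; set h := S x * x; set q := x * S x; set w := 1 - h.
have sh : sa h by exact: sa_starM.
have sq : sa q by rewrite /q starM starK.
have sw : sa w by rewrite starB star1 sh.
have le1 u v : N u <= 1 -> N v <= 1 -> N (u * v) <= 1.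
  move=> u1 v1; apply: le_trans (snormM _ _) _.
  by rewrite mulr_ile1 ?snorm_ge0.
have h1 : N h <= 1 by rewrite le1 ?snorm_star.
have q1 : N q <= 1 by rewrite le1 ?snorm_star.
have key n : N (h * w ^+ (n + n)) <= 1.
  pose y := x * w ^+ n.
  have chw m : GRing.comm h (w ^+ m).
    by apply: commrX; apply: commrB; [exact: commr1|exact: commr_refl].
  have ey : S y * y = h * w ^+ (n + n).
    rewrite /y starM sa_exp// exprD mulrA -[_ * S x * x]mulrA -/h.
    by rewrite -chw -!mulrA.
  have ey' : y * S y = q * (1 - q) ^+ (n + n).
    rewrite /y starM sa_exp// mulrA -[x * _ * _]mulrA -exprD star_mul_comm_exp.
    rewrite -mulrA -/q; apply/commr_sym/commrX/commrB; first exact: commr1.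
    exact: commr_refl.
  have p1 := pos_one_sub_mul_exp (n + n) sh h1.
  have := pos_one_sub_mul_exp (n + n) sq q1; rewrite -ey' => p2.
  (* Adding the symmetric sum to 1 - [y * star y] gives 1 + [star y * y], so both 1 - [star y * y]
     and 1 + [star y * y] are positive. *)
  have := posD p2 (pos_star_sym y); rewrite addrCA subrK addrC => {}p2.
  rewrite -ey; apply: snorm_le; rewrite ?realB_1//; first exact: sa_starM.
  by rewrite ey.
suff w1 : N w <= 1.
  by apply: (@pos_of_snorm _ 1) => //; rewrite realB_1.
rewrite leNgt; apply/negP => w1; set d := N w - 1.
have d0 : 0 < d by rewrite subr_gt0.
(* Let W = N(w)^(2n). The identity w^(2n+1) = w^(2n) - h w^(2n) gives W d <= 1, and Bernoulli's
   inequality gives W >= 1 + 2 n d; these conflict once n d^2 > 1. *)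
have [n dn] : exists n, (d * d)^-1 < n%:R.
  exists (Num.bound (d * d)^-1).
  by rewrite archi_boundP// invr_ge0 mulr_ge0 ?ltW.
have := snormB (w ^+ (n + n)) (h * w ^+ (n + n)).
have -> : w ^+ (n + n) - h * w ^+ (n + n) = w ^+ (n + n).+1.
  by rewrite exprS mulrBl mul1r.
rewrite !snorm_exp// exprS => le.
have b : 1 + (n + n)%:R * d <= N w ^+ (n + n).
  have -> : N w = 1 + d by rewrite /d addrC subrK.
  by apply: bernoulli_ineq; exact: ltW.
rewrite natrD in b; move: (key n) le b.
set W := N w ^+ _; set H := N _ => H1 le b.
have Wd : W * d <= 1 by rewrite /d mulrBr mulr1; lra.
rewrite -(ltr_pM2l (mulr_gt0 d0 d0)) divff ?gt_eqF ?mulr_gt0// in dn.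
have : (1 + n%:R * d) * d <= W * d.
  rewrite ler_pM2r//; have : 0 <= n%:R * d by rewrite mulr_ge0// ltW.
  lra.
nra.
Qed.

Lemma pos_star_mul x : pos (S x * x).
Proof.
have d0 : 0 < 1 + N x by rewrite ltr_pwDl// snorm_ge0.
pose y := (1 + N x)^-1%:C *: x.
have y1 : N y <= 1.
  rewrite snormRZ gtr0_norm ?invr_gt0// -ler_pdivlMl ?invr_gt0//.
  by rewrite invrK mulr1 lerDr.
have := posZ (sqr_ge0 (1 + N x)) (pos_star_mul_le1 y1).
rewrite /y starR -scalerAl -scalerAr !scalerA -!rmorphM/=.
rewrite [X in X%:C](_ : _ = 1) ?scale1r//.
by field; rewrite !gt_eqF.
Qed.

(** Monotonicity of the norm: for m = [star x * x] and t = N(m + s), the element t - m is the sum of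
    the positive elements t - (m + s) and s, so [snorm_le] applies. *)
Lemma snorm_star_mul_le x s : sa s -> pos s -> N x ^+ 2 <= N (S x * x + s).
Proof.
move=> ss ps; rewrite -snorm_star_mul; set m := S x * x; set t := N (m + s).
have sm : sa m by exact: sa_starM.
have t0 : 0 <= t := snorm_ge0 _.
apply: snorm_le => //.
  have -> : t%:B - m = (t%:B - (m + s)) + s by rewrite opprD addrA subrK.
  apply: posD => //; apply: (@pos_of_snorm _ t) => //.
  by rewrite subKr.
apply: posD; last exact: pos_star_mul.
by apply: (@pos_of_snorm _ t) => //; rewrite subrr snorm0.
Qed.

(** * Estimates for the two metric properties *)

Lemma snorm_one_sub_star_mul x : N x <= 1 -> N (1 - S x * x) <= 1.
Proof.
move=> x1; rewrite -realB_1; apply: pos_snorm; first exact: sa_starM.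
  exact: pos_star_mul.
by rewrite snorm_star_mul expr_le1// snorm_ge0.
Qed.

(** Symmetrized so that an element nearly annihilated by [quad x y] is nearly annihilated by x, y
    and their adjoints. *)
Definition quad x y := S x * x + x * S x + (S y * y + y * S y).

Lemma snorm_one_sub_quad x y : N x <= 1 -> N y <= 1 ->
  N (1 - 4^-1%:C *: quad x y) <= 1.
Proof.
move=> x1 y1.
have h z : N z <= 1 -> N (1 - S z * z + (1 - z * S z)) <= 2.
  move=> z1; apply: le_trans (snormD _ _) _.
  have := snorm_one_sub_star_mul z1.
  have : N (S z) <= 1 by rewrite snorm_star.
  by move/snorm_one_sub_star_mul; rewrite starK; lra.
have -> : 1 - 4^-1%:C *: quad x y = 4^-1%:C *:
   ((1 - S x * x + (1 - x * S x)) + (1 - S y * y + (1 - y * S y))).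
  have h1 : (1 : B) = 4^-1%:C *: (1 + 1 + (1 + 1)).
    rewrite -!mulr2n -mulrnA -[X in _ = _ *: X]scaler_nat scalerA.
    rewrite -(rmorph_nat (real_complex R)).
    by rewrite -rmorphM/= mulVf ?pnatr_eq0// scale1r.
  rewrite {1}h1 -scalerBr; congr (_ *: _).
  by rewrite /quad !opprD addrACA; congr (_ + _); rewrite addrACA.
rewrite snormRZ ger0_norm ?invr_ge0//.
have := snormD (1 - S x * x + (1 - x * S x)) (1 - S y * y + (1 - y * S y)).
have := h _ x1; have := h _ y1; lra.
Qed.

(** [g * g] and [star y * y] are nearly orthogonal, so their sum T has N(T)^2 <= 22/10. The cross
    terms add at most 2/10, and sqrt (22/10) + 2/10 < 2. *)
Lemma snorm_sub_lt g y : sa g -> N g <= 1 -> N y <= 1 ->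
  N (y * g) <= 10^-1 -> N (S y * g) <= 10^-1 -> N (g - y) ^+ 2 < 2.
Proof.
move=> sg g1 y1 yg syg.
have le1 u v : N u <= 1 -> N v <= 1 -> N (u * v) <= 1.
  move=> u1 v1; apply: le_trans (snormM _ _) _.
  by rewrite mulr_ile1 ?snorm_ge0.
have hl u v : N u <= 1 -> N v <= 10^-1 -> N (u * v) <= 10^-1.
  move=> u1 v1; apply: le_trans (snormM _ _) _.
  by rewrite -[leRHS]mul1r ler_pM ?snorm_ge0.
have hr u v : N u <= 10^-1 -> N v <= 1 -> N (u * v) <= 10^-1.
  move=> u1 v1; apply: le_trans (snormM _ _) _.
  by rewrite -[leRHS]mulr1 ler_pM ?snorm_ge0.
have sy1 : N (S y) <= 1 by rewrite snorm_star.
have gy : N (g * y) <= 10^-1 by rewrite -snorm_star starM sg.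
have gsy : N (g * S y) <= 10^-1 by rewrite -snorm_star starM sg starK.
pose T := g * g + S y * y.
have sT : sa T by rewrite starD !starM starK sg.
have T2 : N T ^+ 2 <= 22 / 10.
  rewrite -snorm_sqr// {2}/T mulrDr.
  have h1 : N (T * (g * g)) <= 11 / 10.
    rewrite mulrDl; apply: le_trans (snormD _ _) _.
    have : N (g * g * (g * g)) <= 1 by rewrite !le1.
    have : N (S y * y * (g * g)) <= 10^-1.
      by rewrite mulrA -(mulrA _ y) hr// hl.
    lra.
  have h2 : N (T * (S y * y)) <= 11 / 10.
    rewrite mulrDl; apply: le_trans (snormD _ _) _.
    have : N (S y * y * (S y * y)) <= 1 by rewrite !le1.
    have : N (g * g * (S y * y)) <= 10^-1.
      by rewrite mulrA -(mulrA _ g) hr// hl.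
    lra.
  by apply: le_trans (snormD _ _) _; lra.
have : N (g - y) ^+ 2 <= N T + 2 * 10^-1.
  rewrite -snorm_star_mul starB sg.
  have -> : (g - S y) * (g - y) = T - (g * y + S y * g).
    by rewrite mulrBl !mulrBr opprB /T [in RHS]opprD addrACA.
  apply: le_trans (snormB _ _) _; rewrite lerD2l.
  by apply: le_trans (snormD _ _) _; lra.
have := snorm_ge0 T; nra.
Qed.

(** g (quad u v) g is the sum of the four positive elements [star (z * g) * (z * g)], where z is u,
    v or an adjoint of these. Its norm dominates each N(z g)^2, whence N(z g) <= 1/10. *)
Lemma snorm_sub_lt_of_quad g x y : sa g -> N g <= 1 -> N x <= 1 -> N y <= 1 ->
  N (quad x y * g) <= 100^-1 -> N (g - x) ^+ 2 < 2 /\ N (g - y) ^+ 2 < 2.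
Proof.
move=> sg g1.
suff key u v : N u <= 1 -> N v <= 1 -> N (quad u v * g) <= 100^-1 ->
    N (g - u) ^+ 2 < 2.
  move=> x1 y1 q; split; first exact: key q.
  by apply: key (x) _ _ _ => //; rewrite /quad addrC.
move=> u1 v1 q.
have gq : N (g * quad u v * g) <= 100^-1.
  rewrite -mulrA; apply: le_trans (snormM _ _) _.
  by rewrite -[leRHS]mul1r ler_pM ?snorm_ge0.
have pp z : pos (S (z * g) * (z * g)) by exact: pos_star_mul.
have ss z : sa (S (z * g) * (z * g)) by exact: sa_starM.
have e z : S (z * g) * (z * g) = g * (S z * z) * g.
  by rewrite starM sg !mulrA.
have sq (a : R) : 0 <= a -> a ^+ 2 <= 100^-1 -> a <= 10^-1 by move=> a0 a2; nra.
apply: snorm_sub_lt => //; apply: sq; rewrite ?snorm_ge0//; apply: le_trans gq.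
- have := @snorm_star_mul_le (u * g) _
    (sa_add (ss (S u)) (sa_add (ss v) (ss (S v))))
    (posD (pp (S u)) (posD (pp v) (pp (S v)))).
  rewrite !e !starK -!mulrDl -!mulrDr addrA; exact.
- have := @snorm_star_mul_le (S u * g) _
    (sa_add (ss u) (sa_add (ss v) (ss (S v))))
    (posD (pp u) (posD (pp v) (pp (S v)))).
  rewrite !e !starK -!mulrDl -!mulrDr addrA [u * _ + _]addrC; exact.
Qed.

(** Let X be the real part of x. As N(1 + X) <= c, the element c - (1 + X) is positive, and so is c
    - (1 - X); hence N(X) <= c - 1. *)
Lemma snorm_real_part_le x c : 1 <= c -> N (1 - x) <= c -> N (1 + x) <= c ->
  N (2^-1%:C *: (x + S x)) <= c - 1.
Proof.
move=> c1; have c0 : 0 <= c by lra.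
have half y : N y <= c -> N (2^-1%:C *: (y + S y)) <= c.
  move=> yc; rewrite snormRZ ger0_norm ?invr_ge0//.
  by have := snormD y (S y); rewrite snorm_star; lra.
move=> /half h1 /half h2.
have h y : 1 + 2^-1%:C *: (y + S y) = 2^-1%:C *: (1 + y + S (1 + y)).
  by rewrite (starD 1 y) star1 addrACA [in RHS]scalerDr (scale_half_double 1).
have h' : 1 - 2^-1%:C *: (x + S x) = 2^-1%:C *: (1 - x + S (1 - x)).
  by rewrite -h -scalerN opprD raddfN.
have cB : (c - 1)%:B = c%:B - 1 by rewrite realB_D realB_N realB_1.
apply: snorm_le; rewrite ?subr_ge0//.
- by rewrite starR starD starK [X in _ *: X]addrC.
- apply: (@pos_of_snorm _ c) => //; set X := 2^-1%:C *: _ in h *.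
  by rewrite cB -[c%:B - 1 - X]addrA -opprD subKr h.
- apply: (@pos_of_snorm _ c) => //; set X := 2^-1%:C *: _ in h' *.
  have -> : (c - 1)%:B + X = c%:B - (1 - X) by rewrite cB opprB addrA addrAC.
  by rewrite subKr h'.
Qed.

(** The constant 29/20 lies between sqrt 2 and 3/2: the real and imaginary parts have norm at most
    9/20 each. *)
Lemma snorm_lt1_of_unit_roots x :
  (forall j : 'I_4, N (x - 'i%R ^+ j *: 1) <= 29 / 20) -> N x < 1.
Proof.
move=> h.
have c1 : 1 <= 29 / 20 :> R by lra.
have h0 : N (x - 1) <= 29 / 20 by have := h ord0; rewrite expr0 scale1r.
have h1 : N (x - 'i%R *: 1) <= 29 / 20 by have := h (inord 1); rewrite inordK.
have h2 : N (x + 1) <= 29 / 20.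
  by have := h (inord 2); rewrite inordK// sqrCi scaleN1r opprK.
have h3 : N (x + 'i%R *: 1) <= 29 / 20.
  by have := h (inord 3); rewrite inordK// exprS sqrCi mulrN1 scaleNr opprK.
have a : N (2^-1%:C *: (x + S x)) <= 29 / 20 - 1.
  by apply: snorm_real_part_le => //; rewrite ?[N (1 - x)]snorm_distC// addrC.
have ni z : N ('i%R *: z) = N z by rewrite snormZ normCi mul1r.
have b : N (2^-1%:C *: ('i%R *: x + S ('i%R *: x))) <= 29 / 20 - 1.
  apply: snorm_real_part_le => //.
    have -> : 1 - 'i%R *: x = - ('i%R *: (x + 'i%R *: 1)).
      by rewrite scalerDr scalerA -expr2 sqrCi scaleN1r opprB.
    by rewrite snormN ni.
  have -> : 1 + 'i%R *: x = 'i%R *: (x - 'i%R *: 1).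
    by rewrite scalerBr scalerA -expr2 sqrCi scaleN1r opprK addrC.
  by rewrite ni.
have ib : 'i%R *: (2^-1%:C *: ('i%R *: x + S ('i%R *: x))) =
    2^-1%:C *: (S x - x).
  rewrite starI -scalerBr !scalerA mulrAC -expr2 sqrCi mulN1r.
  by rewrite scaleNr -scalerN opprB.
have xE : x = 2^-1%:C *: (x + S x) -
    'i%R *: (2^-1%:C *: ('i%R *: x + S ('i%R *: x))).
  by rewrite ib -scalerBr opprB addrACA subrr addr0 scale_half_double.
rewrite xE; have := snormB (2^-1%:C *: (x + S x))
  ('i%R *: (2^-1%:C *: ('i%R *: x + S ('i%R *: x)))).
by rewrite ni; lra.
Qed.

End CStarSeminormed.

(** * The unitization of a C*-algebra *)

Lemma Re_normc_ge0 (R : rcfType) (k : R[i]) : 0 <= complex.Re `|k|.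
Proof. by rewrite -ler0c RRe_real ?normr_real. Qed.

Section rnorm.
Variables (R : realType) (V : normedModType R[i]).
Implicit Types (v w : V) (c : R).

Definition rnorm v : R := complex.Re `|v|.

Lemma normE v : `|v| = (rnorm v)%:C.
Proof. exact: Re_normE. Qed.

Lemma rnorm_ge0 v : 0 <= rnorm v.
Proof. exact: Re_norm_ge0. Qed.

Lemma rnorm0 : rnorm 0 = 0.
Proof. by rewrite /rnorm normr0. Qed.

Lemma rnorm_eq0 v : rnorm v = 0 -> v = 0.
Proof. by move=> v0; apply: normr0_eq0; rewrite normE v0. Qed.

Lemma rnormD v w : rnorm (v + w) <= rnorm v + rnorm w.
Proof. by rewrite -lecR rmorphD/= -!normE ler_normD. Qed.

Lemma rnormZ (a : R[i]) v : rnorm (a *: v) = complex.Re `|a| * rnorm v.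
Proof.
rewrite {1}/rnorm normrZ (normE v) -[X in X * _](RRe_real (normr_real a)).
by rewrite -rmorphM.
Qed.

Lemma rnormRZ c v : rnorm (c%:C *: v) = `|c| * rnorm v.
Proof. by rewrite rnormZ Re_norm_real. Qed.

Lemma rnormN v : rnorm (- v) = rnorm v.
Proof. by rewrite /rnorm normrN. Qed.

Lemma unit_sphereE v : unit_sphere R[i] V v <-> rnorm v = 1.
Proof.
rewrite /unit_sphere/= normE; split=> [|->//].
by move/(congr1 (@complex.Re R)).
Qed.

End rnorm.

Section cstar_norm.
Variables (R : realType) (A : cstarAlgType R).
Implicit Types a b : A.

Lemma rnorm_cmul a b : rnorm (cmul a b) <= rnorm a * rnorm b.
Proof. by rewrite -lecR rmorphM/= -!normE cnormM. Qed.

Lemma rnorm_cstar_mul a : rnorm (cmul (cstar a) a) = rnorm a ^+ 2.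
Proof. by apply: complexI; rewrite rmorphXn/= -!normE cnorm_star. Qed.

Lemma rnorm_cstar a : rnorm (cstar a) = rnorm a.
Proof.
suff le b : rnorm b <= rnorm (cstar b).
  by apply/eqP; rewrite eq_le le -{2}(cstarK a) le.
have := rnorm_cmul (cstar b) b; rewrite rnorm_cstar_mul expr2.
have := rnorm_ge0 b; rewrite le_eqVlt => /orP[/eqP <- _|b0].
  exact: rnorm_ge0.
by rewrite ler_pM2r.
Qed.

End cstar_norm.

(* The seminorm of the unitization satisfies snorm 1 = 1 only if A != 0; this
   is why the proof of nontriviality is a parameter of the type. *)
Definition unitization (R : realType) (A : cstarAlgType R)
  (A_nontrivial : exists a : A, a != 0) : Type := (R[i]^o * A)%type.

Section unitization.
Variables (R : realType) (A : cstarAlgType R).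
Variable A_nontrivial : exists a : A, a != 0.
Local Notation B := (unitization A_nontrivial).

HB.instance Definition _ := GRing.Lmodule.copy B (R[i]^o * A)%type.

Implicit Types (x y z : B) (a b : A).

Definition umul x y : B :=
  (x.1 * y.1, x.1 *: y.2 + y.1 *: x.2 + cmul x.2 y.2).
Definition uone : B := (1, 0).

Lemma umulA : associative umul.
Proof.
move=> [r a] [s b] [t c]; congr pair; rewrite /= ?mulrA//.
rewrite !scalerDr !linearDl !linearDr/= !linearZl_LR !linearZr_LR/= cmulA.
rewrite !scalerA [t * r]mulrC [t * s]mulrC -!addrA; congr (_ + (_ + _)).
rewrite addrCA; congr (_ + _).
by rewrite [RHS]addrCA; congr (_ + _); rewrite addrCA.
Qed.

Lemma umul1 : left_id uone umul.
Proof.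
by case=> r a; rewrite /umul/= mul1r scale1r scaler0 linear0l !addr0.
Qed.

Lemma umulr1 : right_id uone umul.
Proof.
by case=> r a; rewrite /umul/= mulr1 scale1r scaler0 linear0r add0r addr0.
Qed.

Lemma umulDl : left_distributive umul +%R.
Proof.
move=> [r a] [s b] [t c]; congr pair; rewrite /= ?mulrDl//.
rewrite linearDl/= scalerDl scalerDr [RHS]addrACA; congr (_ + _).
by rewrite addrACA.
Qed.

Lemma umulDr : right_distributive umul +%R.
Proof.
move=> [r a] [s b] [t c]; congr pair; rewrite /= ?mulrDr//.
rewrite linearDr/= scalerDl scalerDr [RHS]addrACA; congr (_ + _).
by rewrite addrACA.
Qed.

Lemma uone_neq0 : uone != 0.
Proof. by apply/eqP => -[/eqP]; rewrite oner_eq0. Qed.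

HB.instance Definition _ :=
  GRing.Zmodule_isNzRing.Build B umulA umul1 umulr1 umulDl umulDr uone_neq0.

Lemma uscaleAl (k : R[i]) x y : k *: (x * y) = (k *: x) * y.
Proof.
case: x y => [r a] [s b]; congr pair; rewrite /=.
  by rewrite -mulrA.
by rewrite linearZl_LR/= !scalerDr !scalerA [k * s]mulrC.
Qed.

HB.instance Definition _ := GRing.Lmodule_isLalgebra.Build R[i] B uscaleAl.

Lemma uscaleAr (k : R[i]) x y : k *: (x * y) = x * (k *: y).
Proof.
case: x y => [r a] [s b]; congr pair; rewrite /=.
  by rewrite [RHS]mulrCA.
by rewrite linearZr_LR/= !scalerDr !scalerA [k * r]mulrC.
Qed.

HB.instance Definition _ := GRing.Lalgebra_isAlgebra.Build R[i] B uscaleAr.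

Definition ustar x : B := (Num.conj (x.1 : R[i]), cstar x.2).

Lemma ustar_is_additive : zmod_morphism ustar.
Proof. by move=> x y; congr pair; rewrite /= ?rmorphB ?raddfB. Qed.

HB.instance Definition _ :=
  GRing.isZmodMorphism.Build B B ustar ustar_is_additive.

Lemma ustar_is_scalable : scalable_for (Num.conj \; *:%R) ustar.
Proof. by move=> c x; congr pair; rewrite /= ?rmorphM// linearZ. Qed.

HB.instance Definition _ :=
  GRing.isScalable.Build R[i] B B (Num.conj \; *:%R) ustar ustar_is_scalable.

Lemma ustarK : involutive ustar.
Proof. by case=> r a; rewrite /ustar/= cstarK conjCK. Qed.

Lemma ustarM x y : ustar (x * y) = ustar y * ustar x.
Proof.
case: x y => [r a] [s b]; congr pair; rewrite /=.
  by rewrite rmorphM mulrC.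
by rewrite !raddfD/= !linearZ/= cstarM [X in X + _]addrC.
Qed.

(** * The operator seminorm of the left action on A *)

Definition uact x b : A := (x.1 : R[i]) *: b + cmul x.2 b.

Definition unorm x : R :=
  sup [set rnorm (uact x b) | b in [set b | rnorm b <= 1]].

Lemma uactM x y b : uact (x * y) b = uact x (uact y b).
Proof.
case: x y => [r a] [s c]; rewrite /uact/=.
rewrite linearDr/= !linearDl/= !linearZl_LR linearZr_LR/= scalerDr cmulA.
by rewrite scalerA -!addrA; congr (_ + _); rewrite [RHS]addrCA addrCA.
Qed.

Lemma uact_has_sup x :
  has_sup [set rnorm (uact x b) | b in [set b | rnorm b <= 1]].
Proof.
split; first by exists (rnorm (uact x 0)); exists 0 => //=; rewrite rnorm0.
exists (complex.Re `|x.1 : R[i]| + rnorm x.2) => _ [b /= b1 <-].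
apply: le_trans (rnormD _ _) _; apply: lerD.
  by rewrite rnormZ ler_piMr// Re_normc_ge0.
by apply: le_trans (rnorm_cmul _ _) _; rewrite ler_piMr// rnorm_ge0.
Qed.

Lemma uactZ x (k : R[i]) b : uact x (k *: b) = k *: uact x b.
Proof. by rewrite /uact linearZr_LR/= scalerDr !scalerA mulrC. Qed.

Lemma unorm_ub x b : rnorm (uact x b) <= unorm x * rnorm b.
Proof.
have := rnorm_ge0 b; rewrite le_eqVlt => /orP[/eqP b0|b0].
  have -> : b = 0 by apply: rnorm_eq0; rewrite -b0.
  by rewrite /uact scaler0 linear0r addr0 rnorm0 mulr0.
rewrite -ler_pdivrMr// mulrC.
have -> : (rnorm b)^-1 * rnorm (uact x b) =
    rnorm (uact x ((rnorm b)^-1%:C *: b)).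
  by rewrite uactZ rnormRZ gtr0_norm ?invr_gt0.
apply: (sup_upper_bound (uact_has_sup x)); exists ((rnorm b)^-1%:C *: b) => //=.
by rewrite rnormRZ gtr0_norm ?invr_gt0// mulVf ?gt_eqF.
Qed.

Lemma unorm_le x (M : R) : (forall b, rnorm b <= 1 -> rnorm (uact x b) <= M) ->
  unorm x <= M.
Proof.
move=> h; apply: ge_sup.
  by exists (rnorm (uact x 0)); exists 0 => //=; rewrite rnorm0.
by move=> _ [b /= b1 <-]; exact: h.
Qed.

Lemma unorm_ge0 x : 0 <= unorm x.
Proof.
apply: (sup_upper_bound (uact_has_sup x)); exists 0; rewrite /= ?rnorm0//.
by rewrite /uact scaler0 linear0r addr0 rnorm0.
Qed.

Lemma unormD x y : unorm (x + y) <= unorm x + unorm y.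
Proof.
apply: unorm_le => b b1.
have -> : uact (x + y) b = uact x b + uact y b.
  by rewrite /uact/= scalerDl linearDl/= addrACA.
apply: le_trans (rnormD _ _) _; apply: lerD.
  by apply: le_trans (unorm_ub _ _) _; rewrite ler_piMr// unorm_ge0.
by apply: le_trans (unorm_ub _ _) _; rewrite ler_piMr// unorm_ge0.
Qed.

Lemma unormZ_le (k : R[i]) x : unorm (k *: x) <= complex.Re `|k| * unorm x.
Proof.
apply: unorm_le => b b1.
have -> : uact (k *: x) b = k *: uact x b.
  by rewrite /uact/= linearZl_LR/= scalerDr scalerA.
rewrite rnormZ ler_wpM2l ?Re_normc_ge0//.
by apply: le_trans (unorm_ub _ _) _; rewrite ler_piMr// unorm_ge0.
Qed.

Lemma unormZ (k : R[i]) x : unorm (k *: x) = complex.Re `|k| * unorm x.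
Proof.
apply/eqP; rewrite eq_le unormZ_le andTb.
have [->|k0] := eqVneq k 0; first by rewrite normr0 mul0r unorm_ge0.
have := unormZ_le k^-1 (k *: x); rewrite scalerA mulVf// scale1r normfV.
have kk : `|k| = (complex.Re `|k|)%:C by rewrite RRe_real ?normr_real.
have k1 : 0 < complex.Re `|k| by rewrite -ltcR -kk normr_gt0.
by rewrite [in X in _ <= X * _]kk -fmorphV ler_pdivlMl.
Qed.

Lemma unormM x y : unorm (x * y) <= unorm x * unorm y.
Proof.
apply: unorm_le => b b1; rewrite uactM.
apply: le_trans (unorm_ub _ _) _; rewrite ler_wpM2l ?unorm_ge0//.
by apply: le_trans (unorm_ub _ _) _; rewrite ler_piMr// unorm_ge0.
Qed.

Lemma unorm1 : unorm 1 = 1.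
Proof.
have u1 b : uact 1 b = b by rewrite /uact/= scale1r linear0l addr0.
apply/eqP; rewrite eq_le; apply/andP; split.
  by apply: unorm_le => b; rewrite u1.
have [a a0] := A_nontrivial.
have := unorm_ub 1 a; rewrite u1 ler_pMl// lt_def rnorm_ge0 andbT.
by apply: contra_neq a0; exact: rnorm_eq0.
Qed.

(** [ustar x] is adjoint to x for the A-valued inner product [cmul (cstar a) b]. *)
Lemma cstar_uact x a b :
  cmul (cstar (uact x a)) b = cmul (cstar a) (uact (ustar x) b).
Proof.
rewrite /uact raddfD/= linearZ/= cstarM linearDl/= linearZl_LR/= -cmulA.
by rewrite linearDr/= linearZr_LR.
Qed.

(** For b in the unit ball, the C*-identity of A makes |x b|^2 the norm of [cstar b] times the
    action of [ustar x * x] on b. *)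
Lemma unorm_star_mul_ge x : unorm x ^+ 2 <= unorm (ustar x * x).
Proof.
have n0 := unorm_ge0 (ustar x * x).
rewrite -(sqr_sqrtr n0) lerXn2r ?nnegrE ?unorm_ge0 ?sqrtr_ge0//.
apply: unorm_le => b b1.
rewrite -(@ler_pXn2r _ 2)// ?nnegrE ?rnorm_ge0 ?sqrtr_ge0// sqr_sqrtr//.
rewrite -rnorm_cstar_mul cstar_uact -uactM.
apply: le_trans (rnorm_cmul _ _) _; rewrite rnorm_cstar.
apply: le_trans (ler_pM _ _ b1 (unorm_ub _ _)) _; rewrite ?rnorm_ge0//.
by rewrite mul1r ler_piMr.
Qed.

Lemma unorm_star x : unorm (ustar x) = unorm x.
Proof.
suff le y : unorm y <= unorm (ustar y).
  by apply/eqP; rewrite eq_le le -{2}(ustarK x) le.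
have := le_trans (unorm_star_mul_ge y) (unormM _ _); rewrite expr2.
have := unorm_ge0 y; rewrite le_eqVlt => /orP[/eqP <- _|y0].
  exact: unorm_ge0.
by rewrite ler_pM2r.
Qed.

Lemma unorm_star_mul x : unorm (ustar x * x) = unorm x ^+ 2.
Proof.
apply/eqP; rewrite eq_le unorm_star_mul_ge andbT.
by apply: le_trans (unormM _ _) _; rewrite unorm_star expr2.
Qed.

HB.instance Definition _ := isCStarSeminormed.Build R B
  ustarK ustarM unormD unormZ unormM unorm1 unorm_star_mul.

Definition uin a : B := (0, a).

Lemma uinM x a : x * uin a = uin (uact x a).
Proof. by case: x => r b; congr pair; rewrite /= ?mulr0// scale0r addr0. Qed.

Lemma uin_star a : star (uin a) = uin (cstar a).
Proof. by congr pair; rewrite /= conjC0. Qed.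

Lemma uinB a b : uin (a - b) = uin a - uin b.
Proof. by congr pair; rewrite /= subr0. Qed.

Lemma uinZ (k : R[i]) a : uin (k *: a) = k *: uin a.
Proof. by congr pair; rewrite /= scaler0. Qed.

Lemma uactE a b : uact (uin a) b = cmul a b.
Proof. by rewrite /uact scale0r add0r. Qed.

(** The lower bound is read off from the action on [cstar a], by the C*-identity. *)
Lemma unorm_uin a : snorm (uin a) = rnorm a.
Proof.
apply/eqP; rewrite eq_le; apply/andP; split.
  apply: unorm_le => b b1; rewrite uactE.
  by apply: le_trans (rnorm_cmul _ _) _; rewrite ler_piMr// rnorm_ge0.
have [->|a0] := eqVneq a 0; first by rewrite rnorm0 unorm_ge0.
have := unorm_ub (uin a) (cstar a).
rewrite uactE -{1}(cstarK a) rnorm_cstar_mul rnorm_cstar expr2 ler_pM2r//.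
by rewrite lt_def rnorm_ge0 andbT; apply: contra_neq a0; exact: rnorm_eq0.
Qed.

End unitization.

(** * Elements almost equal to the unit *)

Section approx_unit.
Variables (R : realType) (A : cstarAlgType R).
Variable A_nontrivial : exists a : A, a != 0.
Local Notation B := (unitization A_nontrivial).
Local Notation uin := (uin A_nontrivial).
Local Notation N := (@snorm R B).

Lemma uinD (a b : A) : uin (a + b) = uin a + uin b.
Proof. by congr pair; rewrite /= addr0. Qed.

Lemma uin_cmul (a b : A) : uin (cmul a b) = uin a * uin b.
Proof. by rewrite uinM uactE. Qed.

(** Powers of 1 - a are congruent to 1 modulo the ideal A, so their Cesaro mean is 1 minus an
    element of A. *)
Lemma sum_exp_uin (a : A) n :
  exists w, \sum_(j < n) (1 - uin a) ^+ j = n%:R - uin w.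
Proof.
have expE m : exists w, (1 - uin a) ^+ m = 1 - uin w.
  elim: m => [|m [w e]]; first by exists 0; rewrite expr0 subr0.
  exists (w + uact (1 - uin w) a).
  by rewrite exprSr e mulrBr mulr1 uinM uinD opprD addrA.
elim: n => [|n [w e]]; first by exists 0; rewrite big_ord0 subr0.
have [w' e'] := expE n; exists (w + w').
by rewrite big_ord_recr/= e e' -natr1 uinD opprD addrACA.
Qed.

Lemma approx_unit (u u' : A) (e : R) : rnorm u = 1 -> rnorm u' = 1 ->
  (forall g, rnorm g = 1 -> 4 <= rnorm (g - u) ^+ 2 + rnorm (g - u') ^+ 2) ->
  0 < e -> exists v : A, N (1 - uin v) <= e.
Proof.
move=> u1 u'1 far e0.
pose q0 : A := cmul (cstar u) u + cmul u (cstar u) +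
  (cmul (cstar u') u' + cmul u' (cstar u')).
have q0E : uin q0 = quad (uin u) (uin u').
  by rewrite /quad /q0 !uinD !uin_cmul !uin_star.
pose a : A := 4^-1%:C *: q0; pose D : B := 1 - uin a.
have D1 : N D <= 1.
  by rewrite /D /a uinZ q0E snorm_one_sub_quad// unorm_uin ?u1 ?u'1.
(* 800 = 4 * 2 * 100, for the bound 4 * 2 / (n e) < 1/100 used in [qg]. *)
have [K [K0 KE]] : exists K : R, 0 <= K /\ K = 800.
  by exists 800; split=> [|//]; exact: ler0n.
have [n nb] : exists n, K / e < n%:R.
  by exists (Num.bound (K / e)); rewrite archi_boundP// divr_ge0// ltW.
have n0 : 0 < n%:R :> R by apply: le_lt_trans nb; rewrite divr_ge0// ltW.
have [w wE] := sum_exp_uin a n; rewrite -/D in wE.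
pose v : A := n%:R^-1%:C *: w; exists v; rewrite leNgt; apply/negP => pe.
set p := 1 - uin v in pe.
have pE : n%:R%:C *: p = \sum_(j < n) D ^+ j.
  rewrite wE /p /v uinZ scalerBr scalerA -rmorphM/= divff ?gt_eqF// scale1r.
  by rewrite rmorph_nat scaler_nat.
(* The geometric sum telescopes: n a p = 1 - D^n, of seminorm at most 2. *)
have ap : n%:R * N (uin a * p) <= 2.
  rewrite -[n%:R]gtr0_norm// -snormRZ scalerAr pE.
  have -> : uin a = - (D - 1) by rewrite opprB subKr.
  rewrite mulNr -subrX1 snormN; apply: le_trans (snormB _ _) _.
  rewrite snorm1; have := snorm_exp_le D n.
  by have := exprn_ile1 n (snorm_ge0 D) D1; lra.
(* p lies outside A; testing it on b in the unit ball yields c = p b in A. *)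
have [b b1 pb] : exists2 b : A, rnorm b <= 1 & e < rnorm (uact p b).
  have : ~ (forall b : A, rnorm b <= 1 -> rnorm (uact p b) <= e).
    by move=> h; move: pe; rewrite ltNge => /negP; apply; exact: unorm_le.
  move=> /existsNP[b /not_implyP[b1 /negP]]; rewrite -ltNge => be.
  by exists b.
set c : A := uact p b in pb; set r := rnorm c in pb.
have r0 : 0 < r := lt_trans e0 pb.
pose g : A := (r ^+ 2)^-1%:C *: cmul c (cstar c).
have r20 : 0 < r ^+ 2 by rewrite exprn_gt0.
have g1 : rnorm g = 1.
  rewrite rnormRZ gtr0_norm ?invr_gt0// -{1}(cstarK c) rnorm_cstar_mul.
  by rewrite rnorm_cstar mulVf ?gt_eqF.
have gE : uin g = (r ^+ 2)^-1%:C *: ((p * uin b) * star (p * uin b)).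
  by rewrite /g uinZ uin_cmul -uin_star uinM.
have Nc : N (p * uin b) = r by rewrite uinM unorm_uin.
have sg : star (uin g) = uin g by rewrite gE starR starM starK.
have qg : N (quad (uin u) (uin u') * uin g) <= 100^-1.
  have -> : quad (uin u) (uin u') = 4%:C *: uin a.
    by rewrite /a uinZ q0E scalerA -rmorphM/= divff ?pnatr_eq0// scale1r.
  rewrite gE -scalerAl -scalerAr !mulrA scalerA -rmorphM/= snormRZ.
  rewrite gtr0_norm ?mulr_gt0 ?invr_gt0//.
  (* a times c and its adjoint begins with a p; the other factors, b and the adjoint of c, have
     norms at most 1 and r. *)
  have h : N (uin a * p * uin b * star (p * uin b)) <= N (uin a * p) * r.
    apply: le_trans (snormM _ _) _; rewrite snorm_star Nc ler_pM2r//.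
    apply: le_trans (snormM _ _) _; rewrite unorm_uin.
    by rewrite ler_piMr// snorm_ge0.
  apply: le_trans (ler_wpM2l _ h) _; first by rewrite mulr_ge0 ?invr_ge0 ?ltW.
  move: ap; set M := N _ => ap.
  have -> : 4 * (r ^+ 2)^-1 * (M * r) = 4 * M / r by field; rewrite gt_eqF.
  rewrite ler_pdivrMr// -(ler_pM2l n0).
  have ner : n%:R * e < n%:R * r by rewrite ltr_pM2l.
  by rewrite ltr_pdivrMr// KE in nb; lra.
have [h1 h2] : N (uin g - uin u) ^+ 2 < 2 /\ N (uin g - uin u') ^+ 2 < 2.
  by apply: snorm_sub_lt_of_quad; rewrite ?unorm_uin ?g1 ?u1 ?u'1.
rewrite -!uinB !unorm_uin in h1 h2.
by have := far _ g1; lra.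
Qed.

End approx_unit.

(** * Functions with values in a Hilbert space *)

Section hilbert.
Variables (R : realType) (H : hilbertType R).
Implicit Types x y : H.

Definition rdot x y : R := complex.Re (hdot x y).

Lemma rnorm_hdot x : (rnorm x ^+ 2)%:C = hdot x x.
Proof. by rewrite rmorphXn/= -normE hdot_norm. Qed.

Lemma rnorm_sqrB x y :
  rnorm (x - y) ^+ 2 = rnorm x ^+ 2 + rnorm y ^+ 2 - 2 * rdot x y.
Proof.
apply: complexI; rewrite rnorm_hdot dnormB rmorphB rmorphD/= !rnorm_hdot.
by congr (_ - _); rewrite rmorphM rmorph_nat/= -addcJ.
Qed.

Lemma rnorm_sqrD x y :
  rnorm (x + y) ^+ 2 = rnorm x ^+ 2 + rnorm y ^+ 2 + 2 * rdot x y.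
Proof.
apply: complexI; rewrite rnorm_hdot dnormD !rmorphD/= !rnorm_hdot.
by congr (_ + _); rewrite rmorphM rmorph_nat/= -addcJ.
Qed.

Lemma rdotZ (c : R) x y : rdot (c%:C *: x) y = c * rdot x y.
Proof.
rewrite /rdot linearZl_LR/=; case: (hdot x y) => a b /=.
by rewrite mul0r subr0.
Qed.

Lemma rdotDr x y z : rdot x (y + z) = rdot x y + rdot x z.
Proof. by rewrite /rdot linearDr raddfD. Qed.

Lemma rdot_suml (n : nat) (x : 'I_n -> H) y :
  rdot (\sum_i x i) y = \sum_i rdot (x i) y.
Proof.
apply: (big_morph (fun z => rdot z y)) => [z z'|]; rewrite /rdot.
  by rewrite linearDl raddfD.
by rewrite linear0l.
Qed.

(** Half of the Cauchy-Schwarz inequality, from the nonnegativity of the squared norm of |y| x +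
    y. *)
Lemma rdot_ge x y : rnorm x = 1 -> - rnorm y <= rdot x y.
Proof.
move=> x1; have := rnorm_ge0 y; rewrite le_eqVlt => /orP[/eqP y0|y0].
  have -> : y = 0 by apply: rnorm_eq0.
  by rewrite rnorm0 /rdot linear0r oppr0.
have := rnorm_sqrD ((rnorm y)%:C *: x) y.
rewrite rnormRZ gtr0_norm// x1 mulr1 rdotZ => e.
have : 0 <= rnorm y * (2 * (rnorm y + rdot x y)).
  apply: le_trans (sqr_ge0 (rnorm ((rnorm y)%:C *: x + y))) _.
  by rewrite e; lra.
by rewrite pmulr_rge0//; lra.
Qed.

(** If M is invertible, c is the preimage of the all-ones row; if M is singular, c is taken in its
    left kernel. *)
Lemma row_nonneg_image (n : nat) (M : 'M[R]_n) : (0 < n)%N ->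
  exists2 c : 'rV[R]_n, c != 0 & forall j, 0 <= (c *m M) 0 j.
Proof.
move=> n0; have [Mu|Mu] := boolP (M \in unitmx).
  exists (const_mx 1 *m invmx M).
    apply/eqP => /(congr1 (mulmxr M))/=; rewrite mulmxKV// mul0mx.
    move/matrixP => /(_ 0 (Ordinal n0)); rewrite !mxE => /eqP.
    by rewrite oner_eq0.
  by move=> j; rewrite mulmxKV// mxE.
have : \det M == 0 by rewrite unitmxE unitfE negbK in Mu.
by move=> /det0P[c c0 cM]; exists c => // j; rewrite cM mxE.
Qed.

(** Two vectors independent over the complex numbers give four real coordinates, as many as there
    are half-spaces, so the conditions form a square real system. *)
Lemma exists_unit_half_spaces (w : 'I_4 -> H) : dim_ge H 2 ->
  exists2 h : H, rnorm h = 1 & forall j, 0 <= rdot h (w j).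
Proof.
move=> [v vf].
pose P : 'M[R]_(2, 2 + 2) := \matrix_(i, j) complex.Re (hdot (v i) (w j)).
(* The sign comes from Re (i z) = - Im z. *)
pose Q : 'M[R]_(2, 2 + 2) := \matrix_(i, j) - complex.Im (hdot (v i) (w j)).
have [c c0 cM] := row_nonneg_image (col_mx P Q) isT.
pose x : 'rV_2 := lsubmx c.
pose y : 'rV_2 := rsubmx c.
have cE : c = row_mx x y by rewrite hsubmxK.
clearbody x y.
pose a i : R[i] := (x 0 i +i* y 0 i)%C.
pose h := \sum_i a i *: v i.
have h0 : h != 0.
  apply: contra_neq c0 => /vf a0; rewrite cE.
  have -> : x = 0 by apply/rowP => i; rewrite [RHS]mxE; case: (a0 i).
  have -> : y = 0 by apply/rowP => i; rewrite [RHS]mxE; case: (a0 i).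
  exact: row_mx0.
have hw j : 0 <= rdot h (w j).
  have := cM j; rewrite cE mul_row_col !mxE -big_split/=.
  suff -> : rdot h (w j) = \sum_(i < 2) (x 0 i * P i j + y 0 i * Q i j) by [].
  rewrite rdot_suml; apply: eq_bigr => i _.
  rewrite /rdot linearZl_LR/= [P i j]mxE [Q i j]mxE mulrN /a.
  by case: (hdot (v i) (w j)).
have n0 : 0 < rnorm h.
  by rewrite lt_def rnorm_ge0 andbT; apply: contra_neq h0; exact: rnorm_eq0.
exists ((rnorm h)^-1%:C *: h).
  by rewrite rnormRZ gtr0_norm ?invr_gt0// mulVf ?gt_eqF.
by move=> j; rewrite rdotZ mulr_ge0// invr_ge0 ltW.
Qed.

End hilbert.

(** * Metric properties of the unit sphere of C(K, H) *)

Section function_space.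
Variables (R : realType) (K : topologicalType) (cK : compact [set: K]).
Variable H : hilbertType R.
Local Notation C := (cfun_space cK H).
Implicit Types f g k : C.

Lemma rnorm_cfun_ub f t : rnorm (f t) <= rnorm f.
Proof. exact: csup_ub. Qed.

Lemma rnorm_cfun_le f (M : R) : 0 <= M -> (forall t, rnorm (f t) <= M) ->
  rnorm f <= M.
Proof. exact: csup_le. Qed.

Definition cconst (x : H) : C := cst x.

Lemma rnorm_cconst x : [set: K] !=set0 -> rnorm (cconst x) = rnorm x.
Proof.
move=> [t _]; apply/eqP; rewrite eq_le; apply/andP; split.
  by apply: rnorm_cfun_le => //; exact: rnorm_ge0.
exact: (rnorm_cfun_ub (cconst x) t).
Qed.

(** At each t the parallelogram law gives 2 |g t|^2 + 2. Were the sum s below 4, all |g t| would be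
    bounded by sqrt (s / 2 - 1) < 1, against |g| = 1. *)
Lemma rnorm_cconst_far x g : rnorm x = 1 -> rnorm g = 1 ->
  4 <= rnorm (g - cconst x) ^+ 2 + rnorm (g - cconst (- x)) ^+ 2.
Proof.
move=> x1 g1; set s := _ + _; rewrite leNgt; apply/negP => s4.
have gt t : 2 * rnorm (g t) ^+ 2 + 2 <= s.
  have h1 := rnorm_cfun_ub (g - cconst x) t.
  have h2 := rnorm_cfun_ub (g - cconst (- x)) t.
  have e1 : rnorm ((g - cconst x : C) t) ^+ 2 =
      rnorm (g t) ^+ 2 + 1 - 2 * rdot (g t) x.
    by have := rnorm_sqrB (g t) x; rewrite x1 expr1n.
  have e2 : rnorm ((g - cconst (- x) : C) t) ^+ 2 =
      rnorm (g t) ^+ 2 + 1 + 2 * rdot (g t) x.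
    by have := rnorm_sqrD (g t) x; rewrite x1 expr1n -{1}(opprK x).
  have : rnorm ((g - cconst x : C) t) ^+ 2 <= rnorm (g - cconst x) ^+ 2.
    by rewrite lerXn2r ?nnegrE ?rnorm_ge0.
  have : rnorm ((g - cconst (- x) : C) t) ^+ 2 <= rnorm (g - cconst (- x)) ^+ 2.
    by rewrite lerXn2r ?nnegrE ?rnorm_ge0.
  rewrite e1 e2 /s; lra.
have s2 : 2 <= s.
  rewrite leNgt; apply/negP => s2.
  suff : rnorm g <= 0 by rewrite g1 ler10.
  apply: rnorm_cfun_le => // t.
  by have := gt t; have := sqr_ge0 (rnorm (g t)); lra.
have : rnorm g <= Num.sqrt (s / 2 - 1).
  apply: rnorm_cfun_le; first exact: sqrtr_ge0.
  move=> t; rewrite -[leLHS]ger0_norm ?rnorm_ge0// -sqrtr_sqr ler_wsqrtr//.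
  by have := gt t; lra.
rewrite g1 leNgt -[ltRHS]sqrtr1 => /negP; apply.
by rewrite ltr_sqrt//; lra.
Qed.

(* p = (1 + 2d)^-1 satisfies p^2 + 2pd <= 1, so the bump need not be supported
   near the zeros of d. *)
Definition bump (d : K -> R) (h : H) (t : K) : H := ((1 + 2 * d t)^-1)%:C *: h.

Lemma bump_continuous (d : K -> R) (h : H) :
  continuous d -> (forall t, 0 <= d t) ->
  continuous (bump d h).
Proof.
move=> dc d0.
have d1 t : 1 + 2 * d t != 0 by rewrite gt_eqF// ltr_pwDl// mulr_ge0.
have pc : continuous (fun t => (1 + 2 * d t)^-1 : R).
  move=> t; apply: cvgV => //; apply: cvgD; first exact: cvg_cst.
  by apply: cvgM; [exact: cvg_cst|exact: dc].
move=> t; apply/cvgrPdist_lt => e e0.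
have n0 : 0 < 1 + rnorm h by rewrite ltr_pwDl// rnorm_ge0.
have eE : e = (complex.Re e)%:C by rewrite RRe_real// gtr0_real.
have e1 : 0 < complex.Re e by rewrite -ltcR -eE.
have /cvgrPdist_lt/(_ _ (divr_gt0 e1 n0)) := pc t.
apply: filterS => s hs.
rewrite normE eE ltcR /bump -scalerBl -rmorphB rnormRZ.
rewrite ltr_pdivlMr// in hs; apply: le_lt_trans hs.
by rewrite ler_wpM2l// lerDr.
Qed.

(** With d t the total deviation of the [v j] from their values at t0, [rdot h (v j t)] is at least
    - d t. For a bump of height p the squared distance at t is then at most p^2 + 1 + 2 p d. *)
Lemma exists_near_orthogonal (v : 'I_4 -> C) :
  [set: K] !=set0 -> dim_ge H 2 -> (forall j, rnorm (v j) = 1) ->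
  exists2 k : C, rnorm k = 1 & forall j, rnorm (k - v j) ^+ 2 <= 2.
Proof.
move=> [t0 _] H2 v1.
have [h h1 hv] := exists_unit_half_spaces (fun j => v j t0) H2.
pose dj j t : R := complex.Re `|(v j - cconst (v j t0) : C) t|.
pose d t : R := \sum_j dj j t.
have dj0 j t : 0 <= dj j t by exact: rnorm_ge0.
have d0 t : 0 <= d t by exact: sumr_ge0.
have djc j : continuous (dj j) by exact: cRe_cts.
have dc : continuous d.
  rewrite /d; elim: (index_enum _) => [|j s IH] t.
    by under eq_fun do rewrite big_nil; exact: cvg_cst.
  under eq_fun do rewrite big_cons; apply: cvgD.
    exact: djc.
  exact: IH.
pose k : C := mkcts (@bump_continuous d h dc d0).
pose p t : R := (1 + 2 * d t)^-1.
have p0 t : 0 < p t by rewrite invr_gt0 ltr_pwDl// mulr_ge0.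
have p1 t : p t <= 1 by rewrite invf_le1 ?ltr_pwDl ?mulr_ge0// lerDl mulr_ge0.
have ktE t : k t = (p t)%:C *: h by [].
have kt t : rnorm (k t) = p t.
  by rewrite ktE rnormRZ gtr0_norm// h1 mulr1.
exists k.
  apply/eqP; rewrite eq_le; apply/andP; split.
    by apply: rnorm_cfun_le => // t; rewrite kt.
  apply: le_trans (rnorm_cfun_ub k t0); rewrite kt /p.
  have -> : d t0 = 0.
    rewrite /d big1// => j _; rewrite /dj.
    have -> : (v j - cconst (v j t0) : C) t0 = 0 by exact: subrr.
    exact: rnorm0.
  by rewrite mulr0 addr0 invr1.
move=> j.
suff : rnorm (k - v j) <= Num.sqrt 2.
  move=> le; rewrite -[leRHS](@sqr_sqrtr _ 2)//.
  by rewrite lerXn2r ?nnegrE ?rnorm_ge0 ?sqrtr_ge0.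
apply: rnorm_cfun_le => [|t]; first exact: sqrtr_ge0.
rewrite -[leLHS]ger0_norm ?rnorm_ge0// -sqrtr_sqr ler_wsqrtr//.
have -> : (k - v j : C) t = k t - v j t by [].
rewrite rnorm_sqrB kt.
have vt : rnorm (v j t) ^+ 2 <= 1.
  by rewrite expr_le1// ?rnorm_ge0// -(v1 j) rnorm_cfun_ub.
have dt : - d t <= rdot h (v j t).
  have -> : v j t = v j t0 + (v j - cconst (v j t0) : C) t.
    by rewrite -[LHS](subrKC (v j t0)).
  rewrite rdotDr.
  have := hv j; have := rdot_ge ((v j - cconst (v j t0) : C) t) h1.
  have : dj j t <= d t.
    by rewrite /d (bigD1 j)//= lerDl sumr_ge0.
  rewrite /dj -/(rnorm _); lra.
rewrite ktE rdotZ.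
have pd : p t * (1 + 2 * d t) = 1.
  by rewrite mulVf// gt_eqF// ltr_pwDl// mulr_ge0.
have := p0 t; have := p1 t; have := d0 t; nra.
Qed.

End function_space.

(** * Contradiction from a surjective isometry *)

Theorem theorem2p1 (R : realType)
    (K : topologicalType) (K_nonempty : [set: K] !=set0)
    (K_compact : compact [set: K]) (K_hausdorff : hausdorff_space K)
    (H : hilbertType R) (H_dim : dim_ge H 2) (A : cstarAlgType R) :
  ~ exists f : {surjfun unit_sphere R[i] (cfun_space K_compact H) >->
                      unit_sphere R[i] A},
      isometry_on (unit_sphere R[i] (cfun_space K_compact H)) f.
Proof.
move=> [f fi]; set C := cfun_space K_compact H in f fi.
have f1 (x : C) : rnorm x = 1 -> rnorm (f x) = 1.
  by move=> /unit_sphereE x1; apply/unit_sphereE; exact: funS.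
have fB (x y : C) : rnorm x = 1 -> rnorm y = 1 ->
    rnorm (f x - f y) = rnorm (x - y).
  move=> /unit_sphereE x1 /unit_sphereE y1; rewrite /rnorm fi//; exact: mem_set.
have fS a : rnorm a = 1 -> exists2 x : C, rnorm x = 1 & f x = a.
  move=> /unit_sphereE /(@surj _ _ _ _ f)[x /unit_sphereE x1 <-].
  by exists x.
(* Zero vectors impose no condition, so this only extracts a unit vector. *)
have [e e1] : exists e : H, rnorm e = 1.
  by have [e e1 _] := exists_unit_half_spaces (fun=> 0) H_dim; exists e.
have c1 (x : H) : rnorm x = 1 -> rnorm (cconst K_compact x) = 1.
  by move=> x1; rewrite rnorm_cconst.
have Ne1 : rnorm (- e) = 1 by rewrite rnormN.
have A0 : exists a : A, a != 0.
  exists (f (cconst K_compact e)); apply/eqP => /(congr1 (@rnorm _ _)).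
  by rewrite rnorm0 f1 ?c1// => /eqP; rewrite oner_eq0.
have e0 : 0 < 100^-1 :> R by rewrite invr_gt0.
have [v vE] : exists v : A, snorm (1 - uin A0 v) <= 100^-1.
  apply: (@approx_unit _ _ _ (f (cconst K_compact e))
                             (f (cconst K_compact (- e)))) => //.
  - by rewrite f1// c1.
  - by rewrite f1// c1.
  move=> _ /fS[g g1 <-]; rewrite !fB ?c1//.
  exact: rnorm_cconst_far.
set r := rnorm v.
have vr : snorm (uin A0 v) = r by rewrite unorm_uin.
have r1 : `|r - 1| <= 100^-1.
  have h1 := snormD (1 - uin A0 v) (uin A0 v).
  have h2 := snormB 1 (1 - uin A0 v).
  rewrite subrK snorm1 vr in h1; rewrite subKr snorm1 vr in h2.
  by rewrite ler_norml; apply/andP; split; lra.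
have r0 : 0 < r by move: r1; rewrite ler_norml => /andP[]; lra.
(* v is normalized to lie in the image of f; as |r - 1| <= 1/100, the bound on its distance to 1
   grows to 1/50. *)
pose w : A := r^-1%:C *: v.
have w1 : rnorm w = 1 by rewrite rnormRZ gtr0_norm ?invr_gt0// mulVf ?gt_eqF.
have wE : snorm (uin A0 w - 1) <= 50^-1.
  have h := snormD (uin A0 (w - v)) (uin A0 v - 1).
  rewrite [X in snorm X](_ : _ = uin A0 w - 1) in h; last first.
    by rewrite uinB addrA subrK.
  apply: le_trans h _; rewrite (snorm_distC _ 1) unorm_uin.
  suff : rnorm (w - v) <= 100^-1 by lra.
  have -> : w - v = (r^-1 - 1)%:C *: v by rewrite rmorphB scalerBl scale1r.
  rewrite rnormRZ -/r -[X in _ * X](gtr0_norm r0) -normrM.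
  by rewrite mulrBl mulVf ?gt_eqF// mul1r distrC.
have iw (j : 'I_4) : rnorm ('i%R ^+ j *: w) = 1.
  by rewrite rnormZ w1 mulr1 normrX normCi expr1n.
have yex (j : 'I_4) : exists x : C, rnorm x = 1 /\ f x = 'i%R ^+ j *: w.
  by have [x x1 fx] := fS _ (iw j); exists x.
have [y yP] := choice yex.
have [k k1 ky] := exists_near_orthogonal K_nonempty H_dim (fun j => (yP j).1).
have : snorm (uin A0 (f k)) < 1.
  apply: snorm_lt1_of_unit_roots => j.
  have -> : uin A0 (f k) - 'i%R ^+ j *: 1 =
      uin A0 (f k - f (y j)) + 'i%R ^+ j *: (uin A0 w - 1).
    by rewrite uinB (yP j).2 uinZ scalerBr addrA subrK.
  apply: le_trans (snormD _ _) _.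
  rewrite unorm_uin fB ?(yP j).1// snormZ normrX normCi expr1n mul1r.
  (* 142/100 is above sqrt 2, and 142/100 + 1/50 < 29/20. *)
  suff : rnorm (k - y j) <= 142 / 100 by lra.
  by have := ky j; have := rnorm_ge0 (k - y j); set a := rnorm _; nra.
by rewrite unorm_uin f1// ltxx.
Qed.
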